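(* Let $1<q<\infty$, $\lambda\in(-\frac1q,0)$, $\gamma\in(-Q,\infty)$, $\omega(x)=|x|_h^{\gamma}$ on $\mathbb H^n$, and $\Omega\in L^{q'}(S_{Q-1})$. Then $\mathcal H_{\Phi,\Omega}$ is bounded from $\dot B^{q,\lambda}_{\omega}(\mathbb H^n)$ to $\dot B^{q,\lambda}_{\omega}(\mathbb H^n)$ if and only if $$\mathcal C_1=\int_0^\infty\frac{\Phi(t)}{t^{1+(Q+\gamma)\lambda}}\,dt<+\infty .$$ Moreover, $$\|\mathcal H_{\Phi,\Omega}\|_{\dot B^{q,\lambda}_\omega(\mathbb H^n)\to\dot B^{q,\lambda}_\omega(\mathbb H^n)}\simeq \mathcal C_1\,\|\Omega\|_{L^{q'}(S_{Q-1})}.$$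
   Context: Heisenberg group. $\mathbb H^n$ is $\mathbb R^{2n}\times\mathbb R$ with Lebesgue measure and group law $x\cdot y=\big(x_1+y_1,\dots,x_{2n}+y_{2n},\,x_{2n+1}+y_{2n+1}+2\sum_{j=1}^n(y_jx_{n+j}-x_jy_{n+j})\big)$; the identity is $0$ and $x^{-1}=-x$. Dilations: $\delta_rx=(rx_1,\dots,rx_{2n},r^2x_{2n+1})$, $r>0$. $Q=2n+2$. Norm: $|x|_h=\big((\sum_{i=1}^{2n}x_i^2)^2+x_{2n+1}^2\big)^{1/4}$. $S_{Q-1}=\{x:|x|_h=1\}$ carries the measure $dy'$ for which the polar coordinate formula $\int_{\mathbb H^n}f(x)dx=\int_0^\infty\int_{S_{Q-1}}f(\delta_ry')r^{Q-1}dy'dr$ holds. $B_R=\{x\in\mathbb H^n:|x|_h\le R\}$. Operator. $\Phi:\mathbb H^n\to[0,\infty)$ is a radial measurable function (so $\Phi(x)$ depends only on $|x|_h$, and one writes $\Phi(t)$ for its value when $|x|_h=t$); $\Omega:S_{Q-1}\to\mathbb C$ is measurable with $\Omega(y)\ne0$ for almost every $y$. The rough Hausdorff operator is $$\mathcal H_{\Phi,\Omega}(f)(x)=\int_{\mathbb H^n}\frac{\Phi(\delta_{|y|_h^{-1}}x)}{|y|_h^{Q}}\Omega(\delta_{|y|_h^{-1}}y)f(y)\,dy=\int_0^\infty\int_{S_{Q-1}}\frac{\Phi(t)}{t}\Omega(y')f(\delta_{t^{-1}|x|_h}y')\,dy'dt .$$ Spaces. For a weight (non-negative measurable function) $\omega$,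 $\omega(K)=\int_K\omega(x)dx$. $L^q_{\omega,\mathrm{loc}}(\mathbb H^n\setminus\{0\})$ is the set of measurable $f$ with $\int_K|f|^q\omega\,dx<\infty$ for every compact $K\subset\mathbb H^n\setminus\{0\}$. For $1\le q<\infty$, $-\frac1q<\lambda<0$, the weighted $\lambda$-central Morrey space $\dot B^{q,\lambda}_\omega(\mathbb H^n)$ consists of $f\in L^q_{\omega,\mathrm{loc}}(\mathbb H^n\setminus\{0\})$ with $$\|f\|_{\dot B^{q,\lambda}_\omega(\mathbb H^n)}=\sup_{R>0}\Big(\frac1{\omega(B_R)^{1+\lambda q}}\int_{B_R}|f(x)|^q\omega(x)dx\Big)^{1/q}<\infty .$$ Conventions. $q'$ is the conjugate exponent of $q$. An operator $T$ is bounded from $X$ to $Y$ if for every $f\in X$ the integral defining $Tf(x)$ converges absolutely for a.e. $x$ and $\|Tf\|_Y\le C\|f\|_X$ with $C$ independent of $f$; $\|T\|_{X\to Y}$ is the least such $C$. $a\simeq b$ means $C^{-1}a\le b\le Ca$ with a constant $C>0$ independent of $\Phi$ and $\Omega$. *)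

(* Defs.v *)
From HB Require Import structures.
From mathcomp Require Import all_boot all_order all_algebra.
From mathcomp Require Import all_classical all_reals all_analysis.
From mathcomp Require Import measurable_realfun complex.

Set Implicit Arguments.
Unset Strict Implicit.
Unset Printing Implicit Defensive.

Import Order.TTheory GRing.Theory Num.Theory.
Import numFieldNormedType.Exports.

Local Open Scope classical_set_scope.
Local Open Scope ring_scope.

(* The library's sigma-finite instance of \x is not found by unification: a
   later instance for products of subprobabilities shadows it. *)
Lemma sigma_finite_product_measure1 d1 d2 (T1 : measurableType d1)
    (T2 : measurableType d2) (R : realType)
    (m1 : {sigma_finite_measure set T1 -> \bar R})
    (m2 : {sigma_finite_measure set T2 -> \bar R}) :
  sigma_finite setT (m1 \x m2)%E.
Proof.
have /sigma_finiteP[F [TF ndF Foo]] := sigma_finiteT m1.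
have /sigma_finiteP[G [TG ndG Goo]] := sigma_finiteT m2.
exists (fun n => F n `*` G n).
  rewrite -setXTT TF TG predeqE => -[x y]; split.
    move=> [/= [n _ Fnx] [k _ Gky]]; exists (maxn n k) => //; split.
    - by move: x Fnx; exact/subsetPset/ndF/leq_maxl.
    - by move: y Gky; exact/subsetPset/ndG/leq_maxr.
  by move=> [n _ []/= ? ?]; split; exists n.
move=> k; have [? ?] := Foo k; have [? ?] := Goo k.
split; first exact: measurableX.
by rewrite product_measure1E// lte_mul_pinfty// ge0_fin_numE.
Qed.

(* R^n is n.-tuple (measurableTypeR R): measurableTypeR R is R itself with the
   Borel sigma-algebra on which lebesgue_measure is defined, and tuples carry
   the product sigma-algebra. *)
Section lebesgue_tuple.
Context {R : realType}.
Local Notation RT := (measurableTypeR R).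

Section cons.
Variables (n : nat) (m : {sigma_finite_measure set (n.-tuple RT) -> \bar R}).

Let consf (p : RT * n.-tuple RT) : n.+1.-tuple RT := [tuple of p.1 :: p.2].

Let measurable_consf : measurable_fun setT consf.
Proof. exact: measurable_cons. Qed.

Definition lebesgue_cons : set (n.+1.-tuple RT) -> \bar R :=
  pushforward (lebesgue_measure \x m)%E (fun p => [tuple of p.1 :: p.2]).

Let lebesgue_cons0 : lebesgue_cons set0 = 0%E.
Proof. by rewrite /lebesgue_cons /pushforward preimage_set0 measure0. Qed.

Let lebesgue_cons_ge0 A : (0 <= lebesgue_cons A)%E.
Proof. exact: measure_ge0. Qed.

Let lebesgue_cons_sigma_additive : semi_sigma_additive lebesgue_cons.
Proof.
exact: (@measure_semi_sigma_additive _ _ _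
  (measure_function_pushforward__canonical__measure_function_Measure
     (lebesgue_measure \x m)%E measurable_consf)).
Qed.

HB.instance Definition _ := isMeasure.Build _ _ _ lebesgue_cons
  lebesgue_cons0 lebesgue_cons_ge0 lebesgue_cons_sigma_additive.

Let lebesgue_cons_sigma_finite : sigma_finite setT lebesgue_cons.
Proof.
have [G TG Gfin] := sigma_finite_product_measure1 lebesgue_measure m.
pose uncons (t : n.+1.-tuple RT) := (thead t, [tuple of behead t]).
have muncons : measurable_fun setT uncons.
  apply/measurable_fun_pairP; split.
    exact: (@measurable_tnth _ RT n.+1 ord0).
  exact: measurable_behead.
have unconsK p : uncons (consf p) = p.
  by case: p => x t; rewrite /uncons /consf /= theadE; congr pair; exact/val_inj.
exists (fun k => uncons @^-1` G k).
  by rewrite -preimage_bigcup -TG preimage_setT.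
move=> k; have [mG Goo] := Gfin k; split.
  by rewrite -[X in measurable X]setTI; exact: muncons.
rewrite /lebesgue_cons /pushforward -comp_preimage.
by rewrite (_ : uncons \o _ = id) //; apply/funext => p; exact: unconsK.
Qed.

HB.instance Definition _ := Measure_isSigmaFinite.Build _ _ _ lebesgue_cons
  lebesgue_cons_sigma_finite.

End cons.

Fixpoint lebesgue_tuple (n : nat) :
    {sigma_finite_measure set (n.-tuple RT) -> \bar R} :=
  match n with
  | 0 => \d_ ([tuple] : 0.-tuple RT)
  | k.+1 => lebesgue_cons (lebesgue_tuple k)
  end.

End lebesgue_tuple.

Section complex_integral.
Context d (T : measurableType d) (R : realType).
Implicit Types (mu : {measure set T -> \bar R}) (D : set T) (f : T -> R[i]).

Definition cmeasurable_fun D f :=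
  measurable_fun D (fun x => complex.Re (f x)) /\
  measurable_fun D (fun x => complex.Im (f x)).

Definition cintegrable mu D f :=
  cmeasurable_fun D f /\
  (\int[mu]_(x in D) (Normc.normc (f x))%:E < +oo)%E.

Definition cintegral mu D f : R[i] :=
  Complex (Rintegral mu D (fun x => complex.Re (f x)))
          (Rintegral mu D (fun x => complex.Im (f x))).

End complex_integral.

Notation heis R n :=
  ((n + n).-tuple (measurableTypeR R) * measurableTypeR R)%type.

Definition homdim (n : nat) : nat := (2 * n + 2)%N.

Section heisenberg.
Context {R : realType} {n : nat}.
Implicit Types (x y : heis R n) (r t : R).

Definition heis_coord x (i : 'I_(n + n)) : R := tnth x.1 i.
Definition heis_height x : R := x.2.

Definition heis_zero : heis R n := ([tuple 0 | i < n + n], 0).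

(* The Heisenberg group law; the operator and the spaces below depend only on
   the dilations, the norm and the (Haar) measure lebesgue_heis. *)
Definition heis_mul x y : heis R n :=
  ([tuple heis_coord x i + heis_coord y i | i < n + n],
   heis_height x + heis_height y +
   2 * \sum_(j < n) (heis_coord y (lshift n j) * heis_coord x (rshift n j) -
                     heis_coord x (lshift n j) * heis_coord y (rshift n j))).

Definition heis_dil r x : heis R n :=
  ([tuple r * heis_coord x i | i < n + n], r ^+ 2 * heis_height x).

Definition heis_norm x : R :=
  ((\sum_(i < n + n) heis_coord x i ^+ 2) ^+ 2 + heis_height x ^+ 2) `^ 4^-1.

Definition heis_ball r : set (heis R n) := [set x | heis_norm x <= r].

Definition heis_sphere : set (heis R n) := [set x | heis_norm x = 1].

Definition lebesgue_heis : set (heis R n) -> \bar R :=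
  (lebesgue_tuple (n + n) \x lebesgue_measure)%E.

HB.instance Definition _ := Measure.on lebesgue_heis.
HB.instance Definition _ := Measure_isSigmaFinite.Build _ _ _ lebesgue_heis
  (sigma_finite_product_measure1 (lebesgue_tuple (n + n)) lebesgue_measure).

(* Tuples carry no topology in the library; R^(2n) gets that of row vectors. *)
Definition heis_compact (K : set (heis R n)) :=
  compact ((fun x =>
    (\row_i heis_coord x i, heis_height x) : 'rV[R]_(n + n) * R) @` K).

(* sigma plays the role of dy'; it is a measure on the whole space, only used
   on subsets of the unit sphere, where this formula determines it. *)
Definition polar_measure (sigma : {measure set (heis R n) -> \bar R}) :=
  forall f : heis R n -> \bar R,
    measurable_fun setT f -> (forall x, 0 <= f x)%E ->
    (\int[lebesgue_heis]_x f x =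
     \int[lebesgue_measure]_(r in `]0%R, +oo[)
       \int[sigma]_(y in heis_sphere)
         (f (heis_dil r y) * (r ^+ (homdim n).-1)%:E))%E.

Definition radial (Phi : heis R n -> R) :=
  forall x y, heis_norm x = heis_norm y -> Phi x = Phi y.

(* The value of a radial Phi at norm t >= 0, read off at the point (0, t^2). *)
Definition radial_profile (Phi : heis R n -> R) t : R :=
  Phi ([tuple 0 | i < n + n], t ^+ 2).

Definition sphere_Lnorm (sigma : {measure set (heis R n) -> \bar R}) (p : R)
    (Omega : heis R n -> R[i]) : \bar R :=
  ((\int[sigma]_(y in heis_sphere) (Normc.normc (Omega y) `^ p)%:E)
     `^ p^-1)%E.

Definition hausdorff_kernel (Phi : heis R n -> R) (Omega f : heis R n -> R[i])
    x y : R[i] :=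
  Complex (Phi (heis_dil (heis_norm y)^-1 x) / heis_norm y ^+ homdim n) 0 *
  Omega (heis_dil (heis_norm y)^-1 y) * f y.

Definition hausdorff (Phi : heis R n -> R) (Omega f : heis R n -> R[i]) x :
    R[i] :=
  cintegral lebesgue_heis setT (hausdorff_kernel Phi Omega f x).

Section morrey.
Variables (q lambda : R) (omega : heis R n -> R).

Definition weight_measure (K : set (heis R n)) : \bar R :=
  \int[lebesgue_heis]_(x in K) (omega x)%:E.

Definition weighted_Lq_int (f : heis R n -> R[i]) (K : set (heis R n)) :
    \bar R :=
  \int[lebesgue_heis]_(x in K) (Normc.normc (f x) `^ q * omega x)%:E.

Definition weighted_Lq_loc (f : heis R n -> R[i]) :=
  cmeasurable_fun setT f /\
  forall K, heis_compact K -> ~ K heis_zero -> (weighted_Lq_int f K < +oo)%E.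

Definition morrey_norm (f : heis R n -> R[i]) : \bar R :=
  ereal_sup [set ((weighted_Lq_int f (heis_ball r) /
                   weight_measure (heis_ball r) `^ (1 + lambda * q)) `^ q^-1)%E
            | r in [set r : R | 0 < r]].

Definition morrey (f : heis R n -> R[i]) :=
  weighted_Lq_loc f /\ (morrey_norm f < +oo)%E.

Definition hausdorff_bounded_by (Phi : heis R n -> R)
    (Omega : heis R n -> R[i]) (C : R) :=
  forall f, morrey f ->
    [/\ (\forall x \ae lebesgue_heis,
           cintegrable lebesgue_heis setT (hausdorff_kernel Phi Omega f x)),
        morrey (hausdorff Phi Omega f) &
        (morrey_norm (hausdorff Phi Omega f) <= C%:E * morrey_norm f)%E].

Definition hausdorff_bounded Phi Omega :=
  exists C : R, hausdorff_bounded_by Phi Omega C.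

Definition hausdorff_opnorm Phi Omega : \bar R :=
  ereal_inf [set C%:E | C in hausdorff_bounded_by Phi Omega].

End morrey.

End heisenberg.

Lemma heis_norm_radial_profile (R : realType) (n : nat) (t : R) : 0 <= t ->
  @heis_norm R n ([tuple 0 | i < n + n], t ^+ 2) = t.
Proof.
move=> t0; rewrite /heis_norm big1 => [|i _]; last first.
  by rewrite /heis_coord tnth_mktuple expr0n.
rewrite expr0n add0r /heis_height/= -exprM -powR_mulrn// -powRrM.
by rewrite mulfV ?pnatr_eq0// powRr1.
Qed.

(* Main.v *)
Require Import Defs.
From mathcomp Require Import all_boot all_order all_algebra.
From mathcomp Require Import all_classical all_reals all_analysis.
From mathcomp Require Import measurable_realfun complex.
From mathcomp Require Import ring lra.

Set Implicit Arguments.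
Unset Strict Implicit.
Unset Printing Implicit Defensive.

Import Order.TTheory GRing.Theory Num.Theory.
Import numFieldNormedType.Exports.

Local Open Scope classical_set_scope.
Local Open Scope ring_scope.

(** Write Q for the homogeneous dimension, alpha = Q + gamma, beta = alpha *
    lambda, C1 for the integral of Phi(t) t^(-beta) dt/t over the half line,
    and s for the total mass of sigma on the unit sphere.  The operator norm
    turns out to be exactly s^(1/q) * C1 * ||Omega||_q', so that the constant K
    only has to dominate s^(1/q) and its inverse.  The function |x|^beta is the
    reason for the weight t^(-beta): it is the homogeneous function that is
    borderline for the Morrey norm, and dilating by 1/t multiplies it by
    t^(-beta).

    Upper bound.  In the integral defining the operator at x, the kernel
    Phi(tau) / |y|^Q with tau = |x| / |y| is split as
      (Phi(tau) tau^(-beta) / |y|^Q)^(1/q')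
        * (Phi(tau) tau^(beta (q-1)) / |y|^Q)^(1/q),
    Omega going with the first factor and f with the second, and Hoelder's
    inequality is applied in y.  In polar coordinates, and after the inversion
    r = |x| / t, the first factor integrates to C1 * ||Omega||_q'^q', whatever x
    is (lemmas [polar_dilated_weight] and [hausdorff_kernel_hoelder]).  The
    q-th power of the second one, integrated against |x|^gamma over a ball, is
    computed by exchanging integrals twice: first x with y, then, once the
    x-integral has been turned into an integral over t = |x| / |y|, y with t.
    What appears is the weighted L^q integral of f over the ball of radius r / t,
    which the Morrey norm controls, and the powers of t combine to t^(-beta-1)
    (lemma [hoelder_density_integral]).

    Lower bound.  Take f(y) = conj(Omega(y')) |Omega(y')|^(q'-2) |y|^beta with
    y' the angular part of y: equality holds in Hoelder's inequality, and the
    operator sends f to C1 * ||Omega||_q'^q' * |x|^beta.  Absolute convergence at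
    a single x forces C1 to be finite, and the Morrey norms of f and of its
    image are explicit, both being integrals of homogeneous functions over balls
    (lemmas [dilation_constant_lty] and [hausdorff_lower_bound]).

    Everything about the polar measure is extracted from its defining formula,
    in the form [polar_product]: the integral of a radial function times a
    function of the angle is a product of integrals.  It gives the sphere a
    positive finite mass, and the balls a weight of the form c r^alpha. *)

(** * Real powers and complex-valued integrals *)

Lemma measurable_bool_indicator d (T : measurableType d) (R : realType)
    (b : T -> bool) : measurable_fun [set: T] b ->
  measurable_fun [set: T] (fun x => (b x)%:R : R).
Proof.
move=> mb; rewrite (_ : (fun _ => _) = fun x => if b x then 1 else 0 : R).
  by apply: measurable_fun_ifT.
by apply/funext => x; case: (b x).
Qed.

Lemma powR_mul_root (R : realType) (p a k : R) : 0 < p -> 0 <= a -> 0 <= k ->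
  (a * k `^ p^-1) `^ p = a `^ p * k.
Proof.
move=> p0 a0 k0; rewrite powRM ?powR_ge0// -powRrM mulVf ?gt_eqF//.
by rewrite powRr1.
Qed.

Lemma powR_inv_opp (R : realType) (s p : R) : 0 <= s -> s^-1 `^ (- p) = s `^ p.
Proof. by move=> s0; rewrite -[s^-1]powR_inv1// -powRrM mulN1r opprK. Qed.

Section complex_integrals.
Context {R : realType}.
Local Notation normc := (@Normc.normc R).

Lemma normcE_powR (z : R[i]) :
  normc z = (complex.Re z ^+ 2 + complex.Im z ^+ 2) `^ 2^-1.
Proof. by case: z => a b; rewrite powR12_sqrt//= addr_ge0 ?sqr_ge0. Qed.

Lemma normc_ge0 (z : R[i]) : 0 <= normc z.
Proof. by rewrite normcE_powR powR_ge0. Qed.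

Lemma sqr_normcE (z : R[i]) :
  normc z ^+ 2 = complex.Re z ^+ 2 + complex.Im z ^+ 2.
Proof. by case: z => a b; rewrite /= sqr_sqrtr// addr_ge0 ?sqr_ge0. Qed.

Lemma normc_eq0 (z : R[i]) : (normc z == 0) = (z == 0).
Proof.
apply/eqP/eqP => [/Normc.eq0_normc//|->].
by rewrite normcE_powR/= !expr0n addr0 powR0// invr_neq0.
Qed.

Lemma normr_Re_le_normc (z : R[i]) : `|complex.Re z| <= normc z.
Proof.
rewrite -(@ler_pXn2r _ 2) ?nnegrE ?normc_ge0// sqr_normcE real_normK ?num_real//.
by rewrite lerDl sqr_ge0.
Qed.

Lemma normr_Im_le_normc (z : R[i]) : `|complex.Im z| <= normc z.
Proof.
rewrite -(@ler_pXn2r _ 2) ?nnegrE ?normc_ge0// sqr_normcE real_normK ?num_real//.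
by rewrite lerDr sqr_ge0.
Qed.

Lemma dot_le_normc (z w : R[i]) :
  complex.Re z * complex.Re w + complex.Im z * complex.Im w
    <= normc z * normc w.
Proof.
apply: le_trans (ler_norm _) _.
rewrite -(@ler_pXn2r _ 2) ?nnegrE ?mulr_ge0 ?normc_ge0//.
rewrite real_normK ?num_real// exprMn !sqr_normcE.
case: z w => [a b] [c e] /=.
suff : 0 <= (a * e - b * c) ^+ 2 by nra.
exact: sqr_ge0.
Qed.

Section measure.
Context d (T : measurableType d) (m : {measure set T -> \bar R}).
Implicit Types (D : set T) (f g : T -> R[i]).

Lemma measurable_normc D f : measurable D -> cmeasurable_fun D f ->
  measurable_fun D (fun x => normc (f x)).
Proof.
move=> mD [mr mi]; under eq_fun do rewrite normcE_powR.
apply: (measurableT_comp (measurable_powR _)).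
by apply: measurable_funD; exact: measurable_funX.
Qed.

(** With z the integral of f, the square of |z| is the integral of the real
    scalar product of z with f, and Cauchy-Schwarz in the plane bounds that
    scalar product by |z| |f|: no constant is lost. *)
Lemma le_normc_cintegral D f : measurable D -> cmeasurable_fun D f ->
  ((normc (cintegral m D f))%:E <= \int[m]_(x in D) (normc (f x))%:E)%E.
Proof.
move=> mD mf; have mn := measurable_normc mD mf; have [mr mi] := mf.
have [|foo] := eqVneq (\int[m]_(x in D) (normc (f x))%:E)%E +oo%E.
  by move=> ->; rewrite leey.
have If : m.-integrable D (EFin \o (fun x => normc (f x))).
  apply/integrableP; split; first exact/measurable_EFinP.
  under eq_integral do rewrite /= ger0_norm ?normc_ge0//.
  by rewrite ltey.
have Ir : m.-integrable D (EFin \o (fun x => complex.Re (f x))).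
  apply: le_integrable If => //; first exact/measurable_EFinP.
  move=> x _ /=; rewrite lee_fin (ger0_norm (normc_ge0 _)).
  exact: normr_Re_le_normc.
have Ii : m.-integrable D (EFin \o (fun x => complex.Im (f x))).
  apply: le_integrable If => //; first exact/measurable_EFinP.
  move=> x _ /=; rewrite lee_fin (ger0_norm (normc_ge0 _)).
  exact: normr_Im_le_normc.
set z := cintegral m D f.
rewrite -[leRHS]fineK; last exact: integrable_fin_num If.
rewrite lee_fin -/(Rintegral m D (fun x => normc (f x))).
have [->|z0] := eqVneq (normc z) 0.
  by apply: Rintegral_ge0 => x _; exact: normc_ge0.
have {}z0 : 0 < normc z by rewrite lt_neqAle eq_sym z0 normc_ge0.
rewrite -(ler_pM2l z0) -expr2 sqr_normcE !expr2.
have Iz : m.-integrable D (EFin \o (fun x => complex.Re z * complex.Re (f x))).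
  exact: integrableZl Ir.
have Iz' : m.-integrable D (EFin \o (fun x => complex.Im z * complex.Im (f x))).
  exact: integrableZl Ii.
rewrite {2 4}/z /= -!RintegralZl// -RintegralD//.
apply: le_Rintegral => //.
- exact: (integrableD mD Iz Iz').
- exact: integrableZl If.
- by move=> x _; exact: (dot_le_normc z (f x)).
Qed.

Lemma integral_bool D (b : T -> bool) (f : T -> \bar R) :
    (forall x, D x <-> b x) ->
  (\int[m]_(x in D) f x = \int[m]_x ((b x)%:R%:E * f x))%E.
Proof.
move=> Db; rewrite integral_mkcond; apply: eq_integral => x _; rewrite patchE.
case: ifPn; rewrite ?inE ?notin_setE Db; first by move=> ->; rewrite mul1e.
by move=> /negP/negPf ->; rewrite mul0e.
Qed.

End measure.
End complex_integrals.

(** The integral is split into positive and negative parts, so measurability in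
    the parameter holds even where the integral diverges. *)
Lemma measurable_Rintegral_param d1 d2 (T1 : measurableType d1)
    (T2 : measurableType d2) (R : realType)
    (m2 : {sigma_finite_measure set T2 -> \bar R}) (g : T1 * T2 -> R) :
  measurable_fun [set: T1 * T2] g ->
  measurable_fun [set: T1] (fun x => Rintegral m2 setT (fun y => g (x, y))).
Proof.
move=> mg; have mEg : measurable_fun [set: T1 * T2] (EFin \o g).
  exact/measurable_EFinP.
apply: (measurableT_comp (fine_measurable measurableT)).
under eq_fun do rewrite integralE.
apply: emeasurable_funB.
- rewrite (_ : (fun _ => _) = fubini_F m2 ((EFin \o g)^\+)%E).
    by apply: measurable_fun_fubini_tonelli_F => //; exact: measurable_funepos.
  by apply/funext => x; apply: eq_integral => y _; rewrite !funeposE.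
- rewrite (_ : (fun _ => _) = fubini_F m2 ((EFin \o g)^\-)%E).
    by apply: measurable_fun_fubini_tonelli_F => //; exact: measurable_funeneg.
  by apply/funext => x; apply: eq_integral => y _; rewrite !funenegE.
Qed.

(** * Power substitutions on the half line *)

Section half_line_substitution.
Context {R : realType}.
Local Notation RT := (measurableTypeR R).
Local Notation leb := (@lebesgue_measure R).
Local Notation pos := (`]0%R, +oo[%classic : set RT).

(** Intervals touching 0 are reached by continuity from below; intersecting both
    measures with the half line makes them comparable on all half-open
    intervals, and hence on all Borel sets. *)
Lemma measure_half_line_unique (m : {measure set RT -> \bar R}) :
    (forall a b : R, 0 < a -> a < b -> m `]a, b]%classic = (b - a)%:E) ->
  forall A, measurable A -> A `<=` pos -> m A = leb A.
Proof.
move=> mab A mA Apos.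
have mpos : measurable pos by exact: measurable_itv.
have mrE (n : {measure set RT -> \bar R}) : n A = mrestr n mpos A.
  by rewrite /mrestr; congr (n _); rewrite setIidl.
rewrite (mrE m) (mrE leb); symmetry.
have restrE (x y : R) : `]x, y]%classic `&` pos =
    `]Num.max x 0, y]%classic :> set R.
  apply/seteqP; split => t /=; rewrite !in_itv/= gt_max.
    by move=> [/andP[-> ->]]; rewrite andbT => ->.
  by move=> /andP[/andP[-> ->] ->].
have m0b (b : R) : 0 < b -> m `]0, b]%classic = b%:E.
  move=> b0; pose F k : set R := `](b / k.+2%:R), b]%classic.
  have Fk k : b / k.+2%:R < b by rewrite ltr_pdivrMr// ltr_pMr// ltr1n.
  have FE : \bigcup_k F k = `]0, b]%classic.
    apply/seteqP; split => t /=.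
      move=> [k _]; rewrite /F/= !in_itv/= => /andP[bt ->]; rewrite andbT.
      by apply: lt_trans bt; rewrite divr_gt0.
    rewrite in_itv/= => /andP[t0 tb].
    have [k kb] : exists k, b / t < k.+2%:R.
      exists (Num.truncn (b / t)).
      apply: (@lt_trans _ _ (Num.truncn (b / t)).+1%:R); last by rewrite ltr_nat.
      by rewrite truncnS_gt.
    exists k => //; rewrite /F/= in_itv/= tb andbT.
    by rewrite ltr_pdivrMr// mulrC -ltr_pdivrMr.
  have cvgF : (m \o F) x @[x --> \oo] --> m `]0, b]%classic.
    rewrite -FE; apply: nondecreasing_cvg_mu.
    - by move=> k; exact: measurable_itv.
    - by rewrite FE; exact: measurable_itv.
    - move=> i j ij; apply/subsetPset => t; rewrite /F/= !in_itv/=.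
      move=> /andP[+ ->]; rewrite andbT; apply: le_lt_trans.
      by rewrite ler_pM2l// lef_pV2 ?posrE// ler_nat.
  have cvgb : (m \o F) x @[x --> \oo] --> b%:E.
    rewrite [X in X @ _](_ : _ = fun k => (b - b / k.+2%:R)%:E); last first.
      by apply/funext => k /=; rewrite mab ?divr_gt0.
    apply: cvg_EFin; first exact: nearW.
    rewrite [X in _ --> X](_ : _ = b - b * 0); last by rewrite mulr0 subr0.
    apply: cvgB; first exact: cvg_cst.
    apply: cvgMr.
    by have := @cvg_harmonic R; rewrite -cvg_shiftS.
  by rewrite -(cvg_unique _ cvgF cvgb).
pose g k : set R := `](- k.+1%:R), k.+1%:R]%classic.
apply: (@measure_unique _ _ RT (@ocitv R) g) => //.
- exact: ocitvI.
- by move=> k; exact: is_ocitv.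
- apply/seteqP; split=> // t _; exists (Num.truncn `|t|) => //.
  rewrite /g/= in_itv/=; have := truncnS_gt `|t|.
  by rewrite ltr_norml => /andP[-> /ltW].
- move=> _ [[x y] _ <-] /=; rewrite /mrestr restrE lebesgue_measure_itv/= lte_fin.
  have [xy|yx] := ltP (Num.max x 0) y; last first.
    by rewrite set_itv_ge ?measure0// bnd_simp -leNgt.
  have [x0|x0] := ltP 0 x.
    by rewrite -EFinB mab// (le_lt_trans _ xy)// le_max lexx.
  by rewrite sube0 m0b// (le_lt_trans _ xy)// le_max lexx orbT.
- move=> k; apply: (@le_lt_trans _ _ (leb (g k))).
    by apply: le_measure; rewrite ?inE//; [apply: measurableI|];
      exact: measurable_itv.
  by rewrite lebesgue_measure_itv/= lte_fin; case: ifPn; rewrite ?ltry.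
Qed.

(** The measure g(t) dt is realised as the area under the graph of g, and the
    right-hand side as its image under F: an integral against a density thus
    becomes a pushforward, and the identity on intervals suffices. *)
Lemma half_line_substitution (F g : R -> R) (h : R -> \bar R) :
    measurable_fun [set: RT] F -> measurable_fun [set: RT] g ->
    (forall t, 0 < t -> 0 < F t) -> (forall t, 0 < t -> 0 <= g t) ->
    (forall a b : R, 0 < a -> a < b -> (
       \int[leb]_(t in pos)
         ((\1_(`]a, b]%classic : set R) (F t))%R%:E * (g t)%:E) =
       (b - a)%:E)%E) ->
    measurable_fun pos h -> (forall t, 0 < t -> (0 <= h t)%E) ->
  (\int[leb]_(t in pos) (h (F t) * (g t)%:E) = \int[leb]_(t in pos) h t)%E.
Proof.
move=> mF mg F0 g0 Fab mh h0.
have mpos : measurable pos by exact: measurable_itv.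
(* Points that are not under the graph are sent to 0, outside the half line. *)
pose psi (z : RT * RT) : RT :=
  if (0 < z.1) && ((0 < z.2) && (z.2 <= g z.1)) then F z.1 else 0.
have mpsi : measurable_fun [set: RT * RT] psi.
  apply: measurable_fun_ifT => /=.
  - apply: measurable_and; first exact: measurable_fun_ltr.
    apply: measurable_and; first exact: measurable_fun_ltr.
    by apply: measurable_fun_ler => //; exact: measurableT_comp.
  - exact: measurableT_comp.
  - exact: measurable_cst.
pose m := pushforward (leb \x leb)%E psi.
pose mm := measure_function_pushforward__canonical__measure_function_Measure
     (leb \x leb)%E mpsi.
have keyE (k : R -> \bar R) : measurable_fun [set: RT] k ->
    (forall t, 0 <= k t)%E -> k 0 = 0%E ->
    (\int[mm]_t k t = \int[leb]_(t in pos) (k (F t) * (g t)%:E))%E.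
  move=> mk k0 kz; rewrite ge0_integral_pushforward//= preimage_setT.
  rewrite fubini_tonelli1//; last exact: measurableT_comp.
  rewrite [RHS]integral_mkcond; apply: eq_integral => t _.
  rewrite /fubini_F /= patchE; case: ifPn => /=; last first.
    rewrite notin_setE/= in_itv/= andbT => /negP t0.
    by rewrite integral0_eq// => s _; rewrite /psi/= (negPf t0).
  rewrite inE/= in_itv/= andbT => t0.
  transitivity (\int[leb]_s (k (F t) * (\1_(`]0%R, g t]%classic : set R) s)%:E))%E.
    apply: eq_integral => s _; rewrite /psi/= t0/= indicE.
    rewrite mem_setE in_itv/=.
    by case: ifP => _; rewrite ?kz ?mule1 ?mule0.
  rewrite ge0_integralZl//; last first.
    by apply/measurable_EFinP; apply: measurable_indic; exact: measurable_itv.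
  rewrite integral_indic//= setIT.
  congr (_ * _)%E; rewrite lebesgue_measure_itv/= lte_fin.
  by case: ltP => gt0; rewrite ?sube0//; congr EFin; apply/eqP;
    rewrite eq_le gt0 g0.
transitivity (\int[mm]_t (h \_ pos) t)%E.
  rewrite keyE//.
  - apply: eq_integral => t; rewrite inE/= in_itv/= andbT => t0.
    by rewrite patchE mem_set//= in_itv/= F0.
  - exact/(measurable_restrictT h).
  - by move=> t; apply: erestrict_ge0 => {}t /=; rewrite in_itv/= andbT => /h0.
  - by rewrite patchE memNset//= in_itv/= ltxx.
rewrite -integral_mkcond; apply: eq_measure_integral => A mA Apos.
apply: (measure_half_line_unique (m := mm)) => // a b a0 ab.
rewrite -Fab// -[X in mm X]setIT -integral_indic//.
rewrite keyE//.
  by apply/measurable_EFinP; apply: measurable_indic; exact: measurable_itv.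
by rewrite indicE mem_setE in_itv/= ltNge (ltW a0).
Qed.

(** The fundamental theorem of calculus away from 0; the booleans choose the ends
    of the interval, because a decreasing power turns ]x, y] into [x', y'[. *)
Lemma integral_powR_derivative (c p lo hi : R) (b0 b1 : bool) : 0 < lo -> lo < hi ->
  (\int[leb]_(t in [set` Interval (BSide b0 lo) (BSide b1 hi)])
     (c * (p * t `^ (p - 1)))%:E)%E = (c * (hi `^ p - lo `^ p))%:E.
Proof.
move=> lo0 lohi.
have gt0 t : t \in `[lo, hi] -> 0 < t.
  by rewrite in_itv/= => /andP[/(lt_le_trans lo0)].
have dpow q t : 0 < t -> derivable ((@powR R) ^~ q) t 1.
  by move=> t0; apply: derivable_powR; rewrite in_itv/= t0.
have cpow q t : 0 < t -> {for t, continuous ((@powR R) ^~ q)}.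
  by move=> t0; apply: differentiable_continuous; apply/derivable1_diffP; exact: dpow.
have mf : measurable_fun [set` `]lo, hi[] (fun t => c * (p * t `^ (p - 1))).
  apply: measurable_funM => //.
  by apply: measurable_funM => //; apply: measurable_funTS; exact: measurable_powR.
rewrite integral_itv_bndoo; last exact/measurable_EFinP.
rewrite -(integral_itv_bndoo true false); last exact/measurable_EFinP.
have -> : (c * (hi `^ p - lo `^ p))%:E = ((c * hi `^ p)%:E - (c * lo `^ p)%:E)%E.
  by rewrite -EFinB mulrBr.
apply: (continuous_FTC2 (f := fun t => c * (p * t `^ (p - 1)))
  (F := fun t => c * t `^ p) lohi).
- apply: continuous_in_subspaceT => t; rewrite inE/= => /gt0 t0.
  by do 2 (apply: cvgMr); exact: cpow.
- split.
  + by move=> t /subset_itv_oo_cc /gt0 t0; apply: derivableZ; apply: dpow.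
  + by apply: cvg_at_right_filter; apply: cvgMr; exact: cpow.
  + by apply: cvg_at_left_filter; apply: cvgMr; apply: cpow; exact: lt_trans lohi.
- move=> t /subset_itv_oo_cc /gt0 t0; rewrite derive1Ml; last exact: dpow.
  by rewrite powR_derive1// in_itv/= t0.
Qed.

(** The three changes of variables needed below are powers t |-> b t^p: scalings
    (p = 1), inversions (p = -1), and p = a to integrate t^(a-1) up to 0. *)
Lemma power_substitution (b p : R) (h : R -> \bar R) :
    0 < b -> p != 0 -> measurable_fun pos h ->
    (forall t, 0 < t -> (0 <= h t)%E) ->
  (\int[leb]_(t in pos) (h (b * t `^ p)%R * (b * (`|p| * t `^ (p - 1)))%:E) =
   \int[leb]_(t in pos) h t)%E.
Proof.
move=> b0 p0 mh h0.
have mpow q : measurable_fun [set: RT] ((@powR R) ^~ q) by exact: measurable_powR.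
apply: (half_line_substitution (F := fun t => b * t `^ p)
  (g := fun t => b * (`|p| * t `^ (p - 1)))) => //.
- exact: measurable_funM.
- by apply: measurable_funM => //; exact: measurable_funM.
- by move=> t t0; rewrite mulr_gt0// powR_gt0.
- by move=> t t0; rewrite !mulr_ge0// ?powR_ge0// ltW.
move=> x y x0 xy.
(* r inverts t |-> b t^p, and pulls ]x, y] back to I, whose closed end depends
   on the sign of p. *)
pose r z := (z / b) `^ p^-1.
have y0 : 0 < y by exact: lt_trans xy.
have zb z : 0 < z -> 0 < z / b by move=> z0; rewrite divr_gt0.
have r0 z : 0 < z -> 0 < r z by move=> z0; rewrite powR_gt0// zb.
have rK z : 0 < z -> b * r z `^ p = z.
  move=> z0; rewrite -powRrM mulVf// powRr1 ?(ltW (zb _ z0))//.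
  by rewrite mulrC divfK// gt_eqF.
have rxy : if 0 < p then r x < r y else r y < r x.
  case: (ltgtP 0 p) p0 => // p0 _.
  - by apply: gt0_ltr_powR;
      rewrite ?invr_gt0 ?nnegrE ?ltr_pM2r ?invr_gt0// ltW// zb.
  - rewrite /r -[X in _ < X]invrK -[X in X < _]invrK.
    rewrite ltf_pV2 ?posrE ?invr_gt0 ?powR_gt0 ?zb// -!powRN.
    by apply: gt0_ltr_powR;
      rewrite ?oppr_gt0 ?invr_lt0 ?nnegrE ?ltr_pM2r ?invr_gt0// ltW// zb.
clearbody r.
pose I := if 0 < p then `]r x, r y] else `[r y, r x[.
have powlt (t s : R) : 0 < t -> 0 < s ->
    (b * t `^ p < b * s `^ p) = if 0 < p then t < s else s < t.
  move=> t0 s0; rewrite ltr_pM2l//; case: (ltgtP 0 p) p0 => // p0 _.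
  - apply/idP/idP; last first.
      by move=> ts; apply: gt0_ltr_powR; rewrite ?nnegrE// ltW.
    apply: contraTT; rewrite -!leNgt => st.
    by apply: ge0_ler_powR; rewrite ?nnegrE// ltW.
  - rewrite -[t `^ p]invrK -[s `^ p]invrK ltf_pV2 ?posrE ?invr_gt0 ?powR_gt0//.
    rewrite -!powRN; apply/idP/idP; last first.
      by move=> st; apply: gt0_ltr_powR; rewrite ?oppr_gt0 ?nnegrE// ltW.
    apply: contraTT; rewrite -!leNgt => ts.
    by apply: ge0_ler_powR; rewrite ?oppr_ge0 ?nnegrE// ltW.
have IE t : 0 < t -> (b * t `^ p \in `]x, y]) = (t \in I).
  move=> t0; have xt := powlt _ _ (r0 x x0) t0; rewrite rK// in xt.
  have ty := powlt _ _ (r0 y y0) t0; rewrite rK// in ty.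
  rewrite in_itv/= xt [X in _ && X]leNgt ty /I.
  by case: ifP => _; rewrite in_itv/= -leNgt// andbC.
have I0 t : t \in I -> 0 < t.
  rewrite /I; case: ifP => _; rewrite in_itv/= => /andP[+ _].
    by apply: lt_trans; exact: r0.
  by apply: lt_le_trans; exact: r0.
transitivity (\int[leb]_(t in [set` I])
    ((b * Num.sg p) * (p * t `^ (p - 1)))%:E)%E.
  rewrite integral_mkcond [RHS]integral_mkcond; apply: eq_integral => t _.
  rewrite !patchE; case: ifPn; rewrite ?notin_setE ?inE/= in_itv/= andbT.
    move=> t0; rewrite indicE mem_setE IE// mem_setE; case: ifP => _.
      by rewrite mul1e -mulrA [Num.sg p * _]mulrA -normrEsg.
    by rewrite mul0e.
  by move=> t0; case: ifPn => //; rewrite inE/= => /I0.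
move: rxy; rewrite /I; case: (ltgtP 0 p) p0 => // p0 _ rxy.
  by rewrite integral_powR_derivative ?r0// gtr0_sg// mulr1 mulrBr !rK.
rewrite integral_powR_derivative ?r0// ltr0_sg// mulrN1 mulrBr !mulNr !rK//.
by rewrite opprK addrC.
Qed.

(** Invariance of dt / t under t |-> s / t. *)
Lemma half_line_inversion (s : R) (h : R -> \bar R) : 0 < s ->
    measurable_fun pos h -> (forall t, 0 < t -> (0 <= h t)%E) ->
  (\int[leb]_(r in pos) (h (s / r)%R * (r^-1)%:E) =
   \int[leb]_(t in pos) (h t * (t^-1)%:E))%E.
Proof.
move=> s0 mh h0.
have powN1 t : 0 < t -> t `^ (-1) = t^-1 by move=> t0; rewrite powR_inv1// ltW.
transitivity (\int[leb]_(t in pos) (h t * (t `^ (-1))%:E))%E; last first.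
  by apply: eq_integral => t; rewrite inE/= in_itv/= andbT => /powN1 ->.
rewrite -(power_substitution (b := s) (p := -1)
  (h := fun t => h t * (t `^ (-1))%:E)%E)//.
- apply: eq_integral => t; rewrite inE/= in_itv/= andbT => t0.
  rewrite powN1// powN1 ?divr_gt0// -muleA -EFinM normrN1 mul1r -opprD powRN.
  rewrite (_ : 1 + 1 = 2%:R :> R)// powR_mulrn ?(ltW t0)//.
  by congr (_ * _%:E)%E; field; rewrite !gt_eqF.
- apply: emeasurable_funM => //; apply/measurable_EFinP.
  by apply: measurable_funTS; exact: measurable_powR.
- by move=> t t0; rewrite mule_ge0 ?h0// lee_fin powR_ge0.
Qed.

Lemma half_line_scaling (r : R) (h : R -> \bar R) : 0 < r ->
    measurable_fun pos h -> (forall t, 0 < t -> (0 <= h t)%E) ->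
  (\int[leb]_(s in pos) (h (s / r)%R * (r^-1)%:E) = \int[leb]_(t in pos) h t)%E.
Proof.
move=> r0 mh h0.
rewrite -[RHS](power_substitution (b := r^-1) (p := 1)) ?invr_gt0//.
apply: eq_integral => t; rewrite inE/= in_itv/= andbT => t0.
by rewrite powRr1 ?(ltW t0)// subrr powRr0 normr1 !mulr1 mulrC.
Qed.

(** Substituting t^a turns the integral into the length of ]0, r^a] divided by
    a, so the singularity at 0 needs no limit. *)
Lemma integral_initial_power (a r : R) : 0 < a -> 0 < r ->
  (\int[leb]_(t in pos) ((t <= r)%R%:R * t `^ (a - 1))%:E = (r `^ a / a)%:E)%E.
Proof.
move=> a0 r0.
pose h (t : R) : \bar R := ((\1_(`]0%R, r `^ a]%classic : set RT) t) / a)%:E.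
have mI : measurable (`]0%R, r `^ a]%classic : set RT) by exact: measurable_itv.
have mh : measurable_fun pos h.
  by apply/measurable_EFinP; apply: measurable_funM => //; exact: measurable_indic.
have := power_substitution (b := 1) (p := a) ltr01 _ mh _.
rewrite (_ : (\int[leb]_(t in pos) h t)%E = (r `^ a / a)%:E); last first.
  under eq_integral do rewrite /h EFinM muleC.
  rewrite ge0_integralZl//=.
  - rewrite integral_indic//= (_ : _ `&` _ = `]0%R, r `^ a]%classic).
      by rewrite lebesgue_measure_itv/= lte_fin powR_gt0// sube0 -EFinM mulrC.
    apply/seteqP; split => t /=; first by case.
    by rewrite !in_itv/= andbT => /andP[-> ->].
  - by apply/measurable_EFinP; exact: measurable_indic.
  - by rewrite lee_fin invr_ge0 ltW.
move=> <-//.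
- apply: eq_integral => t; rewrite inE/= in_itv/= andbT => t0.
  rewrite /h indicE mem_setE in_itv/= !mul1r powR_gt0//= -EFinM gtr0_norm//.
  congr EFin; rewrite (_ : (t `^ a <= r `^ a) = (t <= r)).
    by field; rewrite gt_eqF.
  apply/idP/idP; last by move=> tr; apply: ge0_ler_powR => //; rewrite ?nnegrE ltW.
  apply: contraTT; rewrite -!ltNge => rt.
  by apply: gt0_ltr_powR => //; rewrite ?nnegrE ltW.
- by rewrite gt_eqF.
- by move=> t t0; rewrite /h lee_fin divr_ge0// ltW.
Qed.

End half_line_substitution.

(** * Norm, dilations and polar coordinates *)

Section heisenberg_geometry.
Context {R : realType} {n : nat}.
Local Notation RT := (measurableTypeR R).
Local Notation leb := (@lebesgue_measure R).
Local Notation pos := (`]0%R, +oo[%classic : set RT).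
Local Notation H := (heis R n).
Local Notation mu := (@lebesgue_heis R n).
Local Notation Q := (homdim n).
Implicit Types x y : H.

Lemma measurable_heis_coord (i : 'I_(n + n)) :
  measurable_fun [set: H] (fun x => heis_coord x i).
Proof.
exact: (measurableT_comp (measurable_tnth i) (@measurable_fst _ _ _ _)).
Qed.

Lemma measurable_heis_norm : measurable_fun [set: H] (@heis_norm R n).
Proof.
apply: (measurableT_comp (measurable_powR _)).
apply: measurable_funD; apply: measurable_funX.
  rewrite (_ : (fun _ => _) = (fun x : H => \sum_(i < n + n) heis_coord x i ^+ 2))//.
  apply: measurable_sum => i; apply: measurable_funX; exact: measurable_heis_coord.
exact: measurable_snd.
Qed.

Lemma heis_norm_ge0 x : 0 <= heis_norm x.
Proof. exact: powR_ge0. Qed.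

Lemma heis_norm_dil r x : 0 <= r -> heis_norm (heis_dil r x) = r * heis_norm x.
Proof.
move=> r0; rewrite /heis_norm.
rewrite (_ : _ + _ = r ^+ 4 *
    ((\sum_(i < n + n) heis_coord x i ^+ 2) ^+ 2 + heis_height x ^+ 2)).
  rewrite powRM ?exprn_ge0 ?addr_ge0 ?sqr_ge0// -[r ^+ 4]powR_mulrn// -powRrM.
  by rewrite divff ?powRr1// pnatr_eq0.
rewrite mulrDr; congr (_ + _); last by rewrite /heis_height/= exprMn -exprM.
rewrite (_ : 4 = 2 * 2)%N// exprM -exprMn; congr (_ ^+ 2).
rewrite mulr_sumr; apply: eq_bigr => i _.
by rewrite /heis_coord tnth_mktuple exprMn.
Qed.

Lemma heis_dilM r s x : heis_dil r (heis_dil s x) = heis_dil (r * s) x.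
Proof.
congr pair; last by rewrite /= mulrA exprMn.
apply: eq_from_tnth => i; rewrite !tnth_mktuple /heis_coord tnth_mktuple.
by rewrite mulrA.
Qed.

Lemma heis_dil1 x : heis_dil 1 x = x.
Proof.
rewrite [RHS]surjective_pairing; congr pair; last by rewrite /= expr1n mul1r.
by apply: eq_from_tnth => i; rewrite tnth_mktuple mul1r.
Qed.

Lemma heis_dil0 x : heis_dil 0 x = heis_zero.
Proof.
congr pair; last by rewrite expr0n mul0r.
by apply: eq_from_tnth => i; rewrite !tnth_mktuple mul0r.
Qed.

Lemma measurable_heis_dil (f : H -> R) : measurable_fun [set: H] f ->
  measurable_fun [set: H] (fun x => heis_dil (f x) x).
Proof.
move=> mf; apply: measurable_fun_pair.
  apply/measurable_fun_tnthP => i.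
  rewrite (_ : _ \o _ = fun x => f x * heis_coord x i); last first.
    by apply/funext => x /=; rewrite tnth_mktuple.
  by apply: measurable_funM => //; exact: measurable_heis_coord.
apply: measurable_funM; first exact: measurable_funX.
exact: measurable_snd.
Qed.

Lemma measurable_heis_norm_inv : measurable_fun [set: H] (fun x => (heis_norm x)^-1).
Proof.
rewrite (_ : (fun _ => _) = fun x : H => heis_norm x `^ (-1)).
  exact: (measurableT_comp (measurable_powR _) measurable_heis_norm).
by apply/funext => x; rewrite powR_inv1// heis_norm_ge0.
Qed.

(** The angular part y' of y; it is the origin when y is. *)
Definition heis_angle x : H := heis_dil (heis_norm x)^-1 x.

Lemma heis_norm_angle x : heis_norm x != 0 -> heis_norm (heis_angle x) = 1.
Proof. by move=> x0; rewrite heis_norm_dil ?invr_ge0 ?heis_norm_ge0// mulVf. Qed.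

Lemma heis_angle_dil r y : 0 < r -> heis_norm y = 1 ->
  heis_angle (heis_dil r y) = y.
Proof.
move=> r0 y1; rewrite /heis_angle heis_norm_dil ?ltW// y1 mulr1 heis_dilM.
by rewrite mulVf ?heis_dil1// gt_eqF.
Qed.

Lemma measurable_heis_sphere : measurable (@heis_sphere R n).
Proof.
rewrite -[X in measurable X]setTI.
exact: (measurable_heis_norm measurableT (measurable_set1 1)).
Qed.

Lemma measurable_heis_ball r : measurable (@heis_ball R n r).
Proof.
rewrite -[X in measurable X]setTI.
rewrite (_ : heis_ball r = (@heis_norm R n) @^-1` `]-oo, r]).
  by apply: measurable_heis_norm => //; exact: measurable_itv.
by apply/seteqP; split=> x /=; rewrite in_itv.
Qed.

(** The angle lies on the sphere except at the origin, where the composite is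
    constant, so that measurability on the sphere is enough. *)
Lemma measurable_comp_angle d' (T : measurableType d') (v : H -> T) :
  measurable_fun (@heis_sphere R n) v ->
  measurable_fun [set: H] (fun y => v (heis_angle y)).
Proof.
move=> mv; pose Z := (@heis_norm R n) @^-1` [set 0].
have mZ : measurable Z.
  rewrite -[X in measurable X]setTI.
  exact: (measurable_heis_norm measurableT (measurable_set1 0)).
rewrite -(setUv Z); apply/measurable_funU => //; first exact: measurableC.
split.
  apply: (@eq_measurable_fun _ _ _ _ _ (cst (v heis_zero))) => //.
  by move=> x; rewrite inE /Z/= /heis_angle => ->; rewrite invr0 heis_dil0.
apply: (measurable_comp measurable_heis_sphere) => //.
  by move=> _ [x /eqP x0 <-]; exact: heis_norm_angle.
apply: measurable_funTS; apply: measurable_heis_dil.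
exact: measurable_heis_norm_inv.
Qed.

Lemma lebesgue_measure_setT_neq0 : leb setT != 0%E.
Proof. by rewrite -set_itvNyy lebesgue_measure_itv. Qed.

Lemma lebesgue_tuple_setT_neq0 k : @lebesgue_tuple R k setT != 0%E.
Proof.
elim: k => [|k IH]; first by rewrite /= diracT onee_neq0.
rewrite /= /lebesgue_cons /pushforward preimage_setT -setXTT product_measure1E//.
by rewrite mule_eq0 negb_or IH andbT lebesgue_measure_setT_neq0.
Qed.

Lemma measurable_tuple_box m :
  measurable [set t : m.-tuple RT | forall i, (`|tnth t i : R| <= 1)%R].
Proof.
rewrite (_ : mkset _ = \bigcap_(i in [set: 'I_m])
    ((fun t : m.-tuple RT => tnth t i) @^-1` `[-1, 1]%classic)).
  apply: fin_bigcap_measurable => // i _; rewrite -[X in measurable X]setTI.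
  by apply: measurable_tnth => //; exact: measurable_itv.
apply/seteqP; split => t /= tP i.
  by move=> _; rewrite /= in_itv/= -ler_norml.
by have := tP i I; rewrite /= in_itv/= -ler_norml.
Qed.

(** The unit ball is contained in such a box, and has therefore finite measure. *)
Lemma lebesgue_tuple_box_lty k :
  (@lebesgue_tuple R k [set t | forall i, (`|tnth t i : R| <= 1)%R] < +oo)%E.
Proof.
elim: k => [|k IH] /=; first by rewrite diracE ltry.
rewrite /lebesgue_cons /pushforward.
rewrite (_ : _ @^-1` _ = `[-1, 1]%classic `*`
    [set t : k.-tuple RT | forall i, (`|tnth t i : R| <= 1)%R]); last first.
  apply/seteqP; split => -[a t] /=.
    move=> tP; split; first by have := tP ord0; rewrite in_itv/= -ler_norml tnth0.
    by move=> i; have := tP (lift ord0 i); rewrite tnthS.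
  rewrite in_itv/= -ler_norml => -[a1 tP] i.
  by have [j ->|->] := unliftP ord0 i; rewrite ?tnthS ?tnth0.
rewrite product_measure1E//; last exact: measurable_tuple_box.
apply: lte_mul_pinfty => //.
have := @lebesgue_measure_itv R `[-1, 1].
by rewrite /= lte_fin gtrN// -EFinB => ->.
Qed.

Lemma lebesgue_heis_setT_neq0 : mu setT != 0%E.
Proof.
rewrite /lebesgue_heis -setXTT product_measure1E//.
by rewrite mule_eq0 negb_or lebesgue_tuple_setT_neq0 lebesgue_measure_setT_neq0.
Qed.

Lemma lebesgue_heis_ball1_lty : (mu (heis_ball 1) < +oo)%E.
Proof.
pose B : set H := [set t | forall i, (`|tnth t i : R| <= 1)%R] `*` `[-1, 1]%classic.
have mbox : measurable [set t : (n + n).-tuple RT | forall i, (`|tnth t i : R| <= 1)%R].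
  exact: measurable_tuple_box.
have mB : measurable B by apply: measurableX => //; exact: measurable_itv.
apply: (@le_lt_trans _ _ (mu B)).
  apply: le_measure; rewrite ?inE//; first exact: measurable_heis_ball.
  move=> x /= x1.
  have {}x1 : (\sum_(i < n + n) heis_coord x i ^+ 2) ^+ 2 + heis_height x ^+ 2 <= 1.
    rewrite leNgt; apply/negP => lt1; move: x1; rewrite /heis_ball/= leNgt => /negP; apply.
    apply: (@le_lt_trans _ _ (1 `^ 4^-1)); first by rewrite powR1.
    by apply: gt0_ltr_powR => //; rewrite nnegrE// addr_ge0// sqr_ge0.
  have h1 : heis_height x ^+ 2 <= 1.
    by apply: le_trans x1; rewrite lerDr sqr_ge0.
  have s1 : \sum_(i < n + n) heis_coord x i ^+ 2 <= 1.
    rewrite -(expr_le1 (n := 2))//; last by apply: sumr_ge0 => i _; exact: sqr_ge0.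
    by apply: le_trans x1; rewrite lerDl sqr_ge0.
  have sq1 (a : R) : a ^+ 2 <= 1 -> `|a| <= 1.
    by rewrite -real_normK ?num_real// expr_le1.
  split => /=; last by rewrite in_itv/= -ler_norml; exact: sq1.
  move=> i; apply: sq1; apply: le_trans s1.
  rewrite (bigD1 i)//= lerDl; apply: sumr_ge0 => j _; exact: sqr_ge0.
rewrite /B /lebesgue_heis product_measure1E//.
apply: lte_mul_pinfty => //.
  by rewrite ge0_fin_numE//; exact: lebesgue_tuple_box_lty.
have := @lebesgue_measure_itv R `[-1, 1].
by rewrite /= lte_fin gtrN// -EFinB => ->; rewrite ltry.
Qed.

End heisenberg_geometry.

Section polar_coordinates.
Context {R : realType} {n : nat}.
Context (sigma : {measure set (heis R n) -> \bar R}) (polar : polar_measure sigma).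
Local Notation RT := (measurableTypeR R).
Local Notation leb := (@lebesgue_measure R).
Local Notation pos := (`]0%R, +oo[%classic : set RT).
Local Notation H := (heis R n).
Local Notation mu := (@lebesgue_heis R n).
Local Notation Q := (homdim n).
Implicit Types x y : H.
Local Notation S := (@heis_sphere R n).

(** On the sphere of radius r the norm is constant and the angle recovers the
    point y, so the inner integral of the polar formula factors. *)
Lemma polar_product (u : R -> \bar R) (v : H -> \bar R) :
    measurable_fun [set: RT] u -> (forall r, (0 <= u r)%E) ->
    measurable_fun S v -> (forall y, (0 <= v y)%E) ->
  (\int[mu]_y (u (heis_norm y) * v (heis_angle y)) =
   (\int[leb]_(r in pos) (u r * (r ^+ Q.-1)%:E)) * \int[sigma]_(y in S) v y)%E.
Proof.
move=> m_u u0 mv v0.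
have m_uv : measurable_fun [set: H]
    (fun y => u (heis_norm y) * v (heis_angle y))%E.
  apply: emeasurable_funM; last exact: measurable_comp_angle.
  exact: measurableT_comp measurable_heis_norm.
rewrite polar//; last by move=> y; rewrite mule_ge0.
rewrite -ge0_integralZr//; last 3 first.
- apply: emeasurable_funM; first exact: measurable_funTS.
  by apply/measurable_EFinP; apply: measurable_funTS; exact: measurable_funX.
- move=> r /=; rewrite in_itv/= andbT => r0.
  by rewrite mule_ge0// lee_fin exprn_ge0// ltW.
- exact: integral_ge0.
apply: eq_integral => r; rewrite inE/= in_itv/= andbT => r0.
rewrite -ge0_integralZl//; last 2 first.
- exact: measurable_heis_sphere.
- by rewrite mule_ge0// lee_fin exprn_ge0// ltW.
apply: eq_integral => y; rewrite inE => Sy.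
rewrite heis_norm_dil ?ltW// Sy mulr1 heis_angle_dil//.
by rewrite -!muleA; congr (_ * _)%E; rewrite muleC.
Qed.

Lemma polar_radial (u : R -> \bar R) :
    measurable_fun [set: RT] u -> (forall r, (0 <= u r)%E) ->
  (\int[mu]_y u (heis_norm y) =
   (\int[leb]_(r in pos) (u r * (r ^+ Q.-1)%:E)) * sigma S)%E.
Proof.
move=> m_u u0.
rewrite -[sigma S]mul1e -integral_cst; last exact: measurable_heis_sphere.
by rewrite -polar_product//; apply: eq_integral => y _; rewrite mule1.
Qed.

(** If the sphere were null, the polar formula would make the whole group null. *)
Lemma sphere_measure_gt0 : (0 < sigma S)%E.
Proof.
rewrite lt0e measure_ge0 andbT; apply/eqP => S0.
have /eqP := lebesgue_heis_setT_neq0 (R := R) (n := n); apply.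
rewrite -[LHS]mul1e -integral_cst//.
by rewrite (polar_radial (u := cst 1%E))// S0 mule0.
Qed.

(** Integrals over balls of functions homogeneous of degree g; all the constants
    of the theorem come from this formula. *)
Lemma polar_power (g r : R) (v : H -> \bar R) : 0 < Q%:R + g -> 0 < r ->
    measurable_fun S v -> (forall y, (0 <= v y)%E) ->
  (\int[mu]_y (((heis_norm y <= r)%R%:R * heis_norm y `^ g)%:E * v (heis_angle y)) =
   (r `^ (Q%:R + g) / (Q%:R + g))%:E * \int[sigma]_(y in S) v y)%E.
Proof.
move=> Qg r0 mv v0.
rewrite (polar_product (u := fun t => ((t <= r)%R%:R * t `^ g)%:E))//.
- rewrite -integral_initial_power//; congr (_ * _)%E.
  apply: eq_integral => t; rewrite inE/= in_itv/= andbT => t0.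
  rewrite -EFinM -mulrA -powR_mulrn ?(ltW t0)// -powRD; last first.
    by rewrite (gt_eqF t0) implybT.
  do 3 f_equal; rewrite [Q%:R + g]addrC -addrA; congr (_ + _).
  by rewrite /homdim addn2/= -[in RHS]natr1 addrK.
- apply/measurable_EFinP; apply: measurable_funM; last exact: measurable_powR.
  by apply: measurable_bool_indicator; exact: measurable_fun_ler.
- by move=> t; rewrite lee_fin mulr_ge0// powR_ge0.
Qed.

(** The unit ball has measure sigma(S) / Q by the polar formula, and it has
    finite measure. *)
Lemma sphere_measure_lty : (sigma S < +oo)%E.
Proof.
rewrite ltey; apply/eqP => Soo.
have := lebesgue_heis_ball1_lty (R := R) (n := n); rewrite ltey => /eqP; apply.
have Q0 : 0 < Q%:R + 0 :> R by rewrite addr0 ltr0n /homdim addn2.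
have mB := measurable_heis_ball (R := R) (n := n) 1.
rewrite -[X in mu X]setIT -integral_indic//=.
transitivity (\int[mu]_y (((heis_norm y <= 1)%R%:R * heis_norm y `^ 0)%:E * 1))%E.
  apply: eq_integral => y _; rewrite powRr0 mulr1 mule1 indicE.
  by congr ((nat_of_bool _)%:R%:E); apply/idP/idP; rewrite inE.
rewrite (polar_power (v := cst 1%E))// integral_cst; last exact: measurable_heis_sphere.
by rewrite mul1e powR1 Soo gt0_muley// lte_fin divr_gt0.
Qed.

Lemma lebesgue_heis_zero : mu [set x | heis_norm x = 0] = 0%E.
Proof.
have mZ : measurable [set x : H | heis_norm x = 0].
  rewrite -[X in measurable X]setTI.
  exact: (measurable_heis_norm measurableT (measurable_set1 0)).
rewrite -[X in mu X]setIT -integral_indic//=.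
transitivity (\int[mu]_y (\1_[set 0%R] (heis_norm y) : R)%:E)%E.
  by apply: eq_integral => y _; rewrite !indicE; congr ((nat_of_bool _)%:R%:E);
    apply/idP/idP; rewrite !inE.
rewrite (polar_radial (u := fun r => (\1_[set 0%R] r)%:E)).
- rewrite integral0_eq ?mul0e// => r /=; rewrite in_itv/= andbT => r0.
  by rewrite indicE memNset/= ?mul0e// => rE; rewrite rE ltxx in r0.
- by apply/measurable_EFinP; apply: measurable_indic; exact: measurable_set1.
- by move=> r; rewrite lee_fin.
Qed.

End polar_coordinates.

(** * Central Morrey norms *)

(** The integral of a nonnegative function is a supremum over simple functions,
    hence monotone in the domain without any measurability.  This is for compact
    sets of the group: their compactness refers to row vectors, whose topology
    would otherwise have to be compared with the sigma-algebra of tuples. *)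
Lemma ge0_subset_integral_any d (T : measurableType d) (R : realType)
    (m : {measure set T -> \bar R}) (A B : set T) (f : T -> \bar R) :
    A `<=` B -> (forall x, (0 <= f x)%E) ->
  (\int[m]_(x in A) f x <= \int[m]_(x in B) f x)%E.
Proof.
move=> AB f0; rewrite integral_mkcond [leRHS]integral_mkcond.
rewrite !ge0_integralTE; try by move=> x; exact: erestrict_ge0.
apply: le_ereal_sup => _ [h hf <-]; exists h => // x; apply: le_trans (hf x) _.
rewrite !patchE; case: ifPn => [/set_mem/AB/mem_set -> //|_].
by case: ifPn.
Qed.

Lemma heis_compact_sub_ball (R : realType) (n : nat) (K : set (heis R n)) :
  heis_compact K -> exists2 r : R, 0 < r & K `<=` heis_ball r.
Proof.
move=> /compact_bounded[M [_ KM]].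
pose M1 := Num.max M 0 + 1.
have M1M : M < M1 by rewrite ltr_pwDr// le_max lexx.
have M10 : 0 <= M1 by rewrite addr_ge0// le_max lexx orbT.
pose r4 := (((n + n)%:R * M1 ^+ 2) ^+ 2 + M1 ^+ 2) `^ 4^-1 : R.
exists (r4 + 1); first by rewrite ltr_wpDl// powR_ge0.
move=> x Kx; rewrite /heis_ball/=; apply: (@le_trans _ _ r4); last by rewrite lerDl.
have /= := KM M1 M1M _ (imageP _ Kx).
rewrite prod_normE ge_max /= => /andP[rowM hM].
have sqM (a : R) : `|a| <= M1 -> a ^+ 2 <= M1 ^+ 2.
  by move=> aM; rewrite -(@real_normK _ a) ?num_real// ler_pXn2r ?nnegrE.
have cM i : `|heis_coord x i| <= M1.
  apply: le_trans rowM; rewrite [leRHS]mx_normrE.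
  apply: le_trans (@le_bigmax _ _ _ 0
    (fun ij => `|(\row_j heis_coord x j) ij.1 ij.2|) (ord0, i)).
  by rewrite /= mxE.
apply: ge0_ler_powR; rewrite ?nnegrE ?addr_ge0 ?sqr_ge0//.
apply: lerD; last exact: sqM.
rewrite ler_pXn2r// ?nnegrE ?mulr_ge0 ?sqr_ge0//; last first.
  by apply: sumr_ge0 => i _; exact: sqr_ge0.
apply: (@le_trans _ _ (\sum_(i < n + n) M1 ^+ 2)).
  by apply: ler_sum => i _; apply: sqM.
by rewrite sumr_const card_ord mulr_natl.
Qed.

Section central_morrey.
Context {R : realType} {n : nat}.
Context (sigma : {measure set (heis R n) -> \bar R}) (polar : polar_measure sigma).
Context (q lambda gamma : R).
Context (q_gt0 : 0 < q) (homdim_gamma : 0 < (homdim n)%:R + gamma).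
Local Notation H := (heis R n).
Local Notation mu := (@lebesgue_heis R n).
Local Notation Q := (homdim n).
Local Notation S := (@heis_sphere R n).
Local Notation omega := (fun x : H => heis_norm x `^ gamma).
Local Notation normc := (@Normc.normc R).

(** The closed form of the weight of the ball of radius r > 0, see
    [weight_measure_ball]. *)
Definition ball_weight (r : R) : R :=
  r `^ (Q%:R + gamma) / (Q%:R + gamma) * fine (sigma S).

Lemma sphere_fin : sigma S = (fine (sigma S))%:E.
Proof.
by rewrite fineK// ge0_fin_numE//; exact: sphere_measure_lty.
Qed.

Lemma fine_sphere_gt0 : 0 < fine (sigma S).
Proof. by rewrite -lte_fin -sphere_fin; exact: sphere_measure_gt0. Qed.

Lemma ball_weight_gt0 r : 0 < r -> 0 < ball_weight r.
Proof. by move=> r0; rewrite !mulr_gt0 ?invr_gt0 ?powR_gt0 ?fine_sphere_gt0. Qed.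

Lemma weighted_Lq_int_ballE (f : H -> R[i]) r :
  (weighted_Lq_int q omega f (heis_ball r) =
   \int[mu]_x ((heis_norm x <= r)%R%:R *
     (normc (f x) `^ q * heis_norm x `^ gamma))%:E)%E.
Proof. by rewrite /weighted_Lq_int (integral_bool _ (b := fun x => heis_norm x <= r)). Qed.

Lemma weight_measure_ball r : 0 < r ->
  weight_measure omega (heis_ball r) = (ball_weight r)%:E.
Proof.
move=> r0.
rewrite /weight_measure (integral_bool _ (b := fun x => heis_norm x <= r))//.
transitivity (\int[mu]_x (((heis_norm x <= r)%R%:R * heis_norm x `^ gamma)%:E * 1))%E.
  by apply: eq_integral => x _; rewrite mule1.
rewrite (polar_power polar (v := cst 1%E))// integral_cst; last first.
  exact: measurable_heis_sphere.
by rewrite mul1e sphere_fin -EFinM.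
Qed.

(** The form in which Morrey norms are used: no division and no root, only
    integrals over balls. *)
Lemma morrey_norm_leP (f : H -> R[i]) (M : R) : 0 <= M ->
  (morrey_norm q lambda omega f <= M%:E)%E <->
  forall r, 0 < r -> (weighted_Lq_int q omega f (heis_ball r) <=
     (M `^ q * ball_weight r `^ (1 + lambda * q))%:E)%E.
Proof.
move=> M0.
have W0 r : (0 <= weighted_Lq_int q omega f (heis_ball r))%E.
  by apply: integral_ge0 => x _; rewrite lee_fin mulr_ge0 ?powR_ge0.
have meanP r : 0 < r ->
    ((weighted_Lq_int q omega f (heis_ball r) /
      weight_measure omega (heis_ball r) `^ (1 + lambda * q)) `^ q^-1 <= M%:E)%E <->
    (weighted_Lq_int q omega f (heis_ball r) <=
       (M `^ q * ball_weight r `^ (1 + lambda * q))%:E)%E.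
  move=> r0; rewrite weight_measure_ball//.
  have b0 : 0 < ball_weight r `^ (1 + lambda * q).
    by rewrite powR_gt0// ball_weight_gt0.
  rewrite poweR_EFin inver (gt_eqF b0).
  set W := weighted_Lq_int _ _ _ _; set b := _ `^ _ in b0 *.
  have Wb0 : (0 <= W * b^-1%:E)%E.
    by rewrite mule_ge0 ?W0// lee_fin invr_ge0 ltW.
  split => [WM|WM].
  - have : ((W * b^-1%:E) `^ q^-1 `^ q <= M%:E `^ q)%E.
      apply: gt0_ler_poweR => //; rewrite ?ltW//.
      + by rewrite in_itv/= poweR_ge0 leey.
      + by rewrite in_itv/= lee_fin M0 leey.
    rewrite -poweRrM mulVf ?gt_eqF// poweRe1// poweR_EFin.
    by rewrite lee_pdivrMr// -EFinM.
  - apply: (@le_trans _ _ ((M `^ q)%:E `^ q^-1)%E).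
      apply: gt0_ler_poweR => //.
      + by rewrite invr_ge0 ltW.
      + by rewrite in_itv/= Wb0 leey.
      + by rewrite in_itv/= lee_fin powR_ge0 leey.
      + by rewrite lee_pdivrMr// -EFinM.
    by rewrite poweR_EFin -powRrM divff ?gt_eqF// powRr1.
split => [fM r r0|fM].
  by apply/(meanP _ r0); apply: le_trans fM; apply: ereal_sup_ubound; exists r.
by apply: ge_ereal_sup => _ [r r0 <-]; apply/(meanP _ r0); exact: fM.
Qed.

Lemma morrey_norm_ge0 (f : H -> R[i]) : (0 <= morrey_norm q lambda omega f)%E.
Proof.
apply: le_ereal_sup_tmp; eexists; first by exists 1 => //=; exact: ltr01.
exact: poweR_ge0.
Qed.

(** Compact sets lie in balls, so local integrability follows from the bound on
    balls. *)
Lemma morrey_of_norm_le (f : H -> R[i]) (M : R) : 0 <= M ->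
    cmeasurable_fun setT f -> (morrey_norm q lambda omega f <= M%:E)%E ->
  morrey q lambda omega f.
Proof.
move=> M0 mf fM; split; last by apply: le_lt_trans fM _; rewrite ltry.
split => // K /heis_compact_sub_ball[r r0 Kr] _.
apply: (@le_lt_trans _ _ (weighted_Lq_int q omega f (heis_ball r))).
  apply: ge0_subset_integral_any => // x.
  by rewrite lee_fin mulr_ge0 ?powR_ge0.
by apply: le_lt_trans ((morrey_norm_leP f M0).1 fM r r0) _; rewrite ltry.
Qed.

End central_morrey.

(** * The kernel of the operator *)

Section hausdorff_kernel.
Context {R : realType} {n : nat}.
Local Notation RT := (measurableTypeR R).
Local Notation leb := (@lebesgue_measure R).
Local Notation pos := (`]0%R, +oo[%classic : set RT).
Local Notation H := (heis R n).
Local Notation mu := (@lebesgue_heis R n).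
Local Notation Q := (homdim n).
Local Notation S := (@heis_sphere R n).
Local Notation normc := (@Normc.normc R).
Context (Phi : H -> R) (Omega : H -> R[i]).
Context (mPhi : measurable_fun setT Phi) (Phi_ge0 : forall x, 0 <= Phi x).
Context (rPhi : radial Phi) (mOmega : cmeasurable_fun S Omega).
Local Notation phi := (radial_profile Phi).

Lemma radial_profile_ge0 t : 0 <= phi t.
Proof. exact: Phi_ge0. Qed.

Lemma measurable_radial_profile : measurable_fun [set: RT] phi.
Proof.
by apply: measurableT_comp => //; apply: measurable_fun_pair.
Qed.

Lemma radial_dil (x y : H) :
  Phi (heis_dil (heis_norm y)^-1 x) = phi (heis_norm x / heis_norm y).
Proof.
apply: rPhi; rewrite heis_norm_radial_profile ?divr_ge0 ?heis_norm_ge0//.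
by rewrite heis_norm_dil ?invr_ge0 ?heis_norm_ge0// mulrC.
Qed.

Lemma hausdorff_kernelE (f : H -> R[i]) x y :
  hausdorff_kernel Phi Omega f x y =
  Complex (phi (heis_norm x / heis_norm y) / heis_norm y ^+ Q) 0 *
    Omega (heis_angle y) * f y.
Proof. by rewrite /hausdorff_kernel radial_dil. Qed.

Lemma normc_hausdorff_kernel (f : H -> R[i]) x y :
  normc (hausdorff_kernel Phi Omega f x y) =
  phi (heis_norm x / heis_norm y) / heis_norm y ^+ Q *
    normc (Omega (heis_angle y)) * normc (f y).
Proof.
rewrite hausdorff_kernelE !Normc.normcM; congr (_ * _ * _).
rewrite normcE_powR/= expr0n addr0 powR12_sqrt ?sqr_ge0// sqrtr_sqr ger0_norm//.
by rewrite divr_ge0 ?radial_profile_ge0// exprn_ge0 ?heis_norm_ge0.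
Qed.

Lemma measurable_norm_ratio :
  measurable_fun [set: H * H] (fun z => heis_norm z.1 / heis_norm z.2).
Proof.
apply: measurable_funM.
  exact: (measurableT_comp measurable_heis_norm measurable_fst).
exact: (measurableT_comp measurable_heis_norm_inv measurable_snd).
Qed.

Lemma measurable_norm_invX : measurable_fun [set: H] (fun y => (heis_norm y ^+ Q)^-1).
Proof.
under eq_fun do rewrite -exprVn.
by apply: measurable_funX; exact: measurable_heis_norm_inv.
Qed.

Lemma measurable_hausdorff_kernel (f : H -> R[i]) : cmeasurable_fun setT f ->
  cmeasurable_fun [set: H * H]
    (fun z => hausdorff_kernel Phi Omega f z.1 z.2).
Proof.
move=> [mfr mfi]; have [mOr mOi] := mOmega.
have mk : measurable_fun [set: H * H]
    (fun z => phi (heis_norm z.1 / heis_norm z.2) / heis_norm z.2 ^+ Q).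
  apply: measurable_funM.
    exact: (measurableT_comp measurable_radial_profile measurable_norm_ratio).
  exact: (measurableT_comp measurable_norm_invX measurable_snd).
have m2 (g : H -> R) : measurable_fun setT g ->
    measurable_fun [set: H * H] (fun z => g z.2).
  by move=> mg; exact: (measurableT_comp mg measurable_snd).
have mar := m2 _ (measurable_comp_angle mOr).
have mai := m2 _ (measurable_comp_angle mOi).
have mf2r := m2 _ mfr; have mf2i := m2 _ mfi.
have kE z : hausdorff_kernel Phi Omega f z.1 z.2 =
    Complex
      (phi (heis_norm z.1 / heis_norm z.2) / heis_norm z.2 ^+ Q *
        (complex.Re (Omega (heis_angle z.2)) * complex.Re (f z.2)
         - complex.Im (Omega (heis_angle z.2)) * complex.Im (f z.2)))
      (phi (heis_norm z.1 / heis_norm z.2) / heis_norm z.2 ^+ Q *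
        (complex.Re (Omega (heis_angle z.2)) * complex.Im (f z.2)
         + complex.Im (Omega (heis_angle z.2)) * complex.Re (f z.2))).
  rewrite hausdorff_kernelE; case: (Omega _) => a b; case: (f _) => c e /=.
  move: (_ / _) => k; apply/eqP; rewrite eq_complex/=.
  by apply/andP; split; apply/eqP; ring.
split; under eq_fun do rewrite kE/=.
  by apply: measurable_funM => //; apply: measurable_funB; exact: measurable_funM.
by apply: measurable_funM => //; apply: measurable_funD; exact: measurable_funM.
Qed.

Lemma measurable_hausdorff_kernel2 (f : H -> R[i]) x : cmeasurable_fun setT f ->
  cmeasurable_fun setT (hausdorff_kernel Phi Omega f x).
Proof.
move=> /measurable_hausdorff_kernel[mr mi]; split.
  exact: (measurable_fun_pair2 x mr).
exact: (measurable_fun_pair2 x mi).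
Qed.

Lemma measurable_hausdorff (f : H -> R[i]) : cmeasurable_fun setT f ->
  cmeasurable_fun setT (hausdorff Phi Omega f).
Proof.
move=> /measurable_hausdorff_kernel[mr mi]; split.
  exact: (measurable_Rintegral_param _ mr).
exact: (measurable_Rintegral_param _ mi).
Qed.

End hausdorff_kernel.

(** * Upper bound *)

Section hausdorff_operator.
Context {R : realType} {n : nat}.
Local Notation RT := (measurableTypeR R).
Local Notation leb := (@lebesgue_measure R).
Local Notation pos := (`]0%R, +oo[%classic : set RT).
Local Notation H := (heis R n).
Local Notation mu := (@lebesgue_heis R n).
Local Notation Q := (homdim n).
Local Notation S := (@heis_sphere R n).
Local Notation normc := (@Normc.normc R).
Context (sigma : {measure set H -> \bar R}) (polar : polar_measure sigma).
Context (q q' lambda gamma : R).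
Context (q_gt0 : 0 < q) (q'_gt0 : 0 < q') (conj_qq' : q^-1 + q'^-1 = 1).
Context (homdim_gamma : 0 < (homdim n)%:R + gamma).
Local Notation omega := (fun x : H => heis_norm x `^ gamma).
Local Notation alpha := (Q%:R + gamma).
Context (Phi : H -> R) (Omega : H -> R[i]).
Context (mPhi : measurable_fun setT Phi) (Phi_ge0 : forall x, 0 <= Phi x).
Context (rPhi : radial Phi) (mOmega : cmeasurable_fun S Omega).
Local Notation phi := (radial_profile Phi).

Definition dilation_constant : \bar R :=
  (\int[leb]_(t in pos) (phi t / t `^ (1 + alpha * lambda))%:E)%E.

Lemma dilation_constantE : dilation_constant =
  (\int[leb]_(t in pos) ((phi t * t `^ (- (alpha * lambda)))%:E * (t^-1)%:E))%E.
Proof.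
apply: eq_integral => t; rewrite inE/= in_itv/= andbT => t0.
rewrite -EFinM -mulrA -[t^-1]powR_inv1 ?(ltW t0)// -powRD; last first.
  by rewrite (gt_eqF t0) implybT.
by rewrite -opprD powRN [1 + _]addrC.
Qed.

Lemma dilation_constant_ge0 : (0 <= dilation_constant)%E.
Proof.
apply: integral_ge0 => t _.
by rewrite lee_fin divr_ge0 ?radial_profile_ge0 ?powR_ge0.
Qed.

Lemma measurable_radial_weight (p : R) :
  measurable_fun [set: RT] (fun t => phi t * t `^ p).
Proof.
apply: measurable_funM; first exact: measurable_radial_profile.
exact: measurable_powR.
Qed.

Lemma measurable_dilated_weight (p : R) :
  measurable_fun [set: H * H] (fun z => phi (heis_norm z.1 / heis_norm z.2) *
    (heis_norm z.1 / heis_norm z.2) `^ p / heis_norm z.2 ^+ Q).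
Proof.
apply: measurable_funM; last first.
  exact: (measurableT_comp measurable_norm_invX measurable_snd).
exact: (measurableT_comp (measurable_radial_weight p) measurable_norm_ratio).
Qed.

(** After polar coordinates the radial integral is that of h(|x| / r) dr / r,
    which the inversion r = |x| / t makes independent of x. *)
Lemma polar_dilated_weight (v : H -> \bar R) (x : H) : 0 < heis_norm x ->
    measurable_fun S v -> (forall y, (0 <= v y)%E) ->
  (\int[mu]_y ((phi (heis_norm x / heis_norm y) *
      (heis_norm x / heis_norm y) `^ (- (alpha * lambda)) / heis_norm y ^+ Q)%:E
      * v (heis_angle y)) =
   dilation_constant * \int[sigma]_(y in S) v y)%E.
Proof.
set s := heis_norm x => s0 mv v0.
pose w t := phi t * t `^ (- (alpha * lambda)).
have mw : measurable_fun [set: RT] w by exact: measurable_radial_weight.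
have w0 t : 0 <= w t by rewrite mulr_ge0 ?radial_profile_ge0 ?powR_ge0.
pose u (r : R) : \bar R := (w (s * r `^ (-1)) * (r `^ (-1)) ^+ Q)%:E.
have mi : measurable_fun [set: RT] (fun r : R => r `^ (-1)) by exact: measurable_powR.
have m_u : measurable_fun [set: RT] u.
  apply/measurable_EFinP; apply: measurable_funM; last exact: measurable_funX.
  by apply: measurableT_comp => //; exact: measurable_funM.
transitivity (\int[mu]_y (u (heis_norm y) * v (heis_angle y)))%E.
  apply: eq_integral => y _; congr (_ * _)%E.
  by rewrite /u powR_inv1 ?heis_norm_ge0// exprVn.
rewrite (polar_product polar)//; last first.
  by move=> r; rewrite lee_fin mulr_ge0// exprn_ge0 ?powR_ge0.
congr (_ * _)%E; rewrite dilation_constantE.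
rewrite -(half_line_inversion (h := EFin \o w) s0); last 2 first.
- by apply/measurable_EFinP; exact: measurable_funTS.
- by move=> t _; rewrite lee_fin.
apply: eq_integral => r; rewrite inE/= in_itv/= andbT => r0.
rewrite /u powR_inv1 ?(ltW r0)// -!EFinM -mulrA; congr (_ * _)%:E.
rewrite exprVn (_ : Q = Q.-1.+1); last by rewrite /homdim addn2.
by rewrite /= exprS invfM -mulrA mulVf ?mulr1// expf_neq0// gt_eqF.
Qed.

(** The q-th power of the factor containing f in Hoelder's inequality. *)
Definition hoelder_density (f : H -> R[i]) (x : H) : \bar R :=
  (\int[mu]_y (normc (f y) `^ q *
     (phi (heis_norm x / heis_norm y) *
      (heis_norm x / heis_norm y) `^ (alpha * lambda * (q - 1))
      / heis_norm y ^+ Q))%:E)%E.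

Lemma hoelder_density_ge0 f x : (0 <= hoelder_density f x)%E.
Proof.
apply: integral_ge0 => y _; rewrite lee_fin mulr_ge0 ?powR_ge0//.
by rewrite !mulr_ge0 ?radial_profile_ge0 ?powR_ge0 ?invr_ge0 ?exprn_ge0 ?heis_norm_ge0.
Qed.

(** The exponents of tau = s / r cancel because (q - 1) / q = 1 / q'; at r = 0 both
    sides vanish, as the inverse of 0 is 0. *)
Lemma hoelder_split (s r : R) : 0 < s -> 0 <= r ->
  (phi (s / r) * (s / r) `^ (- (alpha * lambda)) / r ^+ Q) `^ q'^-1 *
  (phi (s / r) * (s / r) `^ (alpha * lambda * (q - 1)) / r ^+ Q) `^ q^-1 =
  phi (s / r) / r ^+ Q.
Proof.
move=> s0; rewrite le_eqVlt => /predU1P[<-|r0].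
  have Q0 : (Q == 0)%N = false by rewrite /homdim addn2.
  rewrite expr0n Q0 /= !invr0 !mulr0.
  by rewrite !powR0 ?mulr0// invr_neq0// gt_eqF.
have t0 : 0 < s / r by rewrite divr_gt0.
set t := s / r in t0 *.
have k0 : 0 <= phi t / r ^+ Q.
  by rewrite divr_ge0 ?radial_profile_ge0// exprn_ge0// ltW.
rewrite !(mulrAC (phi t) (t `^ _)); set k := phi t / r ^+ Q in k0 *.
clearbody k; clearbody t.
rewrite !powRM ?powR_ge0// mulrACA -!powRrM -!powRD; last 2 first.
- by rewrite (gt_eqF t0) implybT.
- by rewrite addrC conj_qq' oner_eq0.
rewrite [q'^-1 + _]addrC conj_qq' powRr1//.
have qE : (q - 1) / q = q'^-1.
  by rewrite mulrBl divff ?gt_eqF// mul1r -conj_qq' [q^-1 + _]addrC addrK.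
by rewrite -[alpha * lambda * (q - 1) / q]mulrA qE mulNr addNr powRr0 mulr1.
Qed.

Lemma hausdorff_kernel_hoelder (f : H -> R[i]) (x : H) :
    cmeasurable_fun setT f -> 0 < heis_norm x ->
  (\int[mu]_y (normc (hausdorff_kernel Phi Omega f x y))%:E <=
   (dilation_constant *
      \int[sigma]_(y in S) (normc (Omega y) `^ q')%:E) `^ q'^-1 *
   hoelder_density f x `^ q^-1)%E.
Proof.
move=> mf x0.
have mN : measurable_fun S (fun y => normc (Omega y)).
  by apply: measurable_normc => //; exact: measurable_heis_sphere.
have mNf : measurable_fun setT (fun y => normc (f y)) by exact: measurable_normc.
pose K (p : R) (y : H) := phi (heis_norm x / heis_norm y) *
  (heis_norm x / heis_norm y) `^ p / heis_norm y ^+ Q.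
have mK p : measurable_fun setT (K p).
  exact: (measurable_fun_pair2 x (measurable_dilated_weight p)).
have K0 p y : 0 <= K p y.
  by rewrite !mulr_ge0 ?radial_profile_ge0 ?powR_ge0 ?invr_ge0 ?exprn_ge0
    ?heis_norm_ge0.
pose f1 (y : H) := normc (Omega (heis_angle y)) * K (- (alpha * lambda)) y `^ q'^-1.
pose f2 (y : H) := normc (f y) * K (alpha * lambda * (q - 1)) y `^ q^-1.
have mf1 : measurable_fun setT f1.
  apply: measurable_funM; first exact: (measurable_comp_angle mN).
  exact: (measurableT_comp (measurable_powR _)).
have mf2 : measurable_fun setT f2.
  apply: measurable_funM => //.
  exact: (measurableT_comp (measurable_powR _)).
have f12 y : normc (hausdorff_kernel Phi Omega f x y) = f1 y * f2 y.
  rewrite normc_hausdorff_kernel// /f1 /f2 mulrACA.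
  by rewrite hoelder_split ?heis_norm_ge0// [RHS]mulrC mulrA.
have q'q : q'^-1 + q^-1 = 1 by rewrite addrC.
have := hoelder mu mf1 mf2 q'_gt0 q_gt0 q'q.
rewrite Lnorm1 unlock /Lnorm => hld.
apply: le_trans (le_trans _ hld) _.
  rewrite le_eqVlt; apply/orP; left; apply/eqP.
  apply: eq_integral => y _; rewrite /= f12 ger0_norm//.
  by rewrite !mulr_ge0 ?normc_ge0 ?powR_ge0.
rewrite le_eqVlt; apply/orP; left; apply/eqP; congr (_ `^ _ * _ `^ _)%E.
- rewrite -(polar_dilated_weight (v := fun y => (normc (Omega y) `^ q')%:E) x0)//.
  + apply: eq_integral => y _; rewrite /= /f1 ger0_norm ?mulr_ge0 ?normc_ge0 ?powR_ge0//.
    by rewrite powR_mul_root ?normc_ge0// mulrC.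
  + apply/measurable_EFinP.
    exact: (measurableT_comp (measurable_powR _)).
  + by move=> y; rewrite lee_fin powR_ge0.
- rewrite /hoelder_density; apply: eq_integral => y _.
  rewrite /= /f2 ger0_norm ?mulr_ge0 ?normc_ge0 ?powR_ge0//.
  by rewrite powR_mul_root ?normc_ge0.
Qed.

(** The powers of t left after the two exchanges of integrals: from the measure,
    from the Hoelder weight, and from the weight of the ball of radius r / t. *)
Lemma dilated_weight_exponents (t : R) : 0 < t ->
  t `^ (alpha - 1) * (phi t * t `^ (alpha * lambda * (q - 1))) *
    (t `^ (- alpha)) `^ (1 + lambda * q) =
  phi t * t `^ (- (alpha * lambda)) * t `^ (-1).
Proof.
move=> t0; rewrite [t `^ (alpha - 1) * _]mulrCA -!mulrA; congr (_ * _).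
rewrite -powRrM -!powRD; try by rewrite (gt_eqF t0) implybT.
by congr (_ `^ _); ring.
Qed.

(** Prepares the substitution t |-> t / s of [half_line_scaling], which replaces
    the radius t of x by the ratio t / s of the radii of x and y. *)
Lemma dilated_weight_scaling (c r s t : R) : 0 < s -> 0 < t ->
  ((t <= r)%R%:R * t `^ gamma) *
    (c * (phi (t / s) * (t / s) `^ (alpha * lambda * (q - 1)) / s ^+ Q)) *
    t ^+ Q.-1 =
  (t / s) `^ (alpha - 1) * (phi (t / s) * (t / s) `^ (alpha * lambda * (q - 1))) *
    ((t / s * s <= r)%R%:R * (c * s `^ gamma)) * s^-1.
Proof.
move=> s0 t0; rewrite divfK ?gt_eqF//.
move: (phi (t / s) * _) => k; move: (_ <= r)%R%:R => b.
rewrite powRM ?ltW ?invr_gt0//.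
have -> : t `^ (alpha - 1) = t `^ gamma * t ^+ Q.-1.
  rewrite -powR_mulrn ?(ltW t0)// -powRD; last by rewrite (gt_eqF t0) implybT.
  rewrite [alpha]addrC -addrA; congr (_ `^ (_ + _)).
  by rewrite /homdim addn2/= -[in LHS]natr1 addrK.
have -> : s^-1 `^ (alpha - 1) = (s `^ gamma * s ^+ Q * s^-1)^-1.
  rewrite -[s^-1 in LHS]powR_inv1 ?(ltW s0)// -powRrM mulN1r powRN; congr (_^-1).
  rewrite -powR_mulrn ?(ltW s0)// -[s^-1]powR_inv1 ?(ltW s0)//.
  rewrite -!powRD; try by rewrite (gt_eqF s0) implybT.
  by rewrite [Q%:R + gamma]addrC.
have sg : s `^ gamma != 0 by rewrite gt_eqF// powR_gt0.
have sQ : s ^+ Q != 0 by rewrite expf_neq0// gt_eqF.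
by field; rewrite sg sQ gt_eqF.
Qed.

Lemma ball_weight_div r t : 0 < r -> 0 < t ->
  ball_weight sigma gamma (r / t) = ball_weight sigma gamma r * t `^ (- alpha).
Proof.
move=> r0 t0; rewrite /ball_weight powRM ?ltW ?invr_gt0//.
rewrite -[t^-1 in LHS]powR_inv1 ?(ltW t0)// -powRrM mulN1r.
by rewrite -!mulrA; congr (_ * _); rewrite mulrC -!mulrA.
Qed.

(** Tonelli in (x, y), then polar coordinates and scaling in x, then Tonelli in
    (y, t): the inner integral is then a weighted integral of f over the ball of
    radius r / t, to which the Morrey bound applies. *)
Lemma hoelder_density_integral (f : H -> R[i]) (M r : R) :
    cmeasurable_fun setT f -> 0 < r ->
    (forall r, 0 < r -> (weighted_Lq_int q omega f (heis_ball r) <=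
      (M `^ q * ball_weight sigma gamma r `^ (1 + lambda * q))%:E)%E) ->
  (\int[mu]_x (((heis_norm x <= r)%R%:R * heis_norm x `^ gamma)%:E *
      hoelder_density f x) <=
   (fine (sigma S) * (M `^ q * ball_weight sigma gamma r `^ (1 + lambda * q)))%:E
     * dilation_constant)%E.
Proof.
move=> mf r0 fM.
set sg := fine (sigma S).
have sg0 : 0 < sg by exact: fine_sphere_gt0.
have mNf : measurable_fun setT (fun y => normc (f y)) by exact: measurable_normc.
pose Nf (y : H) := normc (f y) `^ q.
have mN : measurable_fun setT Nf by exact: (measurableT_comp (measurable_powR _)).
have Nf0 y : 0 <= Nf y by exact: powR_ge0.
pose D (x y : H) := phi (heis_norm x / heis_norm y) *
  (heis_norm x / heis_norm y) `^ (alpha * lambda * (q - 1)) / heis_norm y ^+ Q.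
have mD : measurable_fun [set: H * H] (fun z => D z.1 z.2).
  exact: measurable_dilated_weight.
have D0 x y : 0 <= D x y.
  by rewrite !mulr_ge0 ?radial_profile_ge0 ?powR_ge0 ?invr_ge0 ?exprn_ge0
    ?heis_norm_ge0.
pose b (x : H) : R := (heis_norm x <= r)%R%:R * heis_norm x `^ gamma.
have mb : measurable_fun setT b.
  apply: measurable_funM.
    apply: measurable_bool_indicator; apply: measurable_fun_ler => //.
    exact: measurable_heis_norm.
  exact: (measurableT_comp (measurable_powR _) measurable_heis_norm).
have b0 x : 0 <= b x by rewrite mulr_ge0 ?powR_ge0.
(* G is the integrand before the exchange of x and y, and T the one after the
   substitution, with t ranging over the half line. *)
pose G (z : H * H) := (b z.1 * (Nf z.2 * D z.1 z.2))%:E.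
have mG : measurable_fun setT G.
  apply/measurable_EFinP; apply: measurable_funM.
    exact: (measurableT_comp mb measurable_fst).
  by apply: measurable_funM => //; exact: (measurableT_comp mN measurable_snd).
have G0 z : (0 <= G z)%E.
  by rewrite lee_fin; exact: (mulr_ge0 (b0 _) (mulr_ge0 (Nf0 _) (D0 _ _))).
pose w (t : R) := t `^ (alpha - 1) * (phi t * t `^ (alpha * lambda * (q - 1))).
have mw : measurable_fun [set: RT] w.
  apply: measurable_funM; first exact: measurable_powR.
  exact: measurable_radial_weight.
have w0 t : 0 <= w t by rewrite !mulr_ge0 ?powR_ge0 ?radial_profile_ge0.
pose T (z : H * RT) : \bar R := ((0 < z.2)%R%:R * (sg *
  (w z.2 * ((z.2 * heis_norm z.1 <= r)%R%:R * (Nf z.1 * heis_norm z.1 `^ gamma)))))%:E.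
have m1 : measurable_fun [set: H * RT] (fun z => heis_norm z.1).
  exact: (measurableT_comp measurable_heis_norm measurable_fst).
have mT : measurable_fun setT T.
  apply/measurable_EFinP; apply: measurable_funM.
    by apply: measurable_bool_indicator; exact: measurable_fun_ltr.
  apply: measurable_funM => //; apply: measurable_funM.
    exact: (measurableT_comp mw measurable_snd).
  apply: measurable_funM.
    apply: measurable_bool_indicator; apply: measurable_fun_ler => //.
    exact: measurable_funM.
  apply: measurable_funM; first exact: (measurableT_comp mN measurable_fst).
  exact: (measurableT_comp (measurable_powR _) m1).
have T0 z : (0 <= T z)%E.
  rewrite lee_fin; apply: mulr_ge0 => //; apply: (mulr_ge0 (ltW sg0)).
  apply: (mulr_ge0 (w0 _)); apply: mulr_ge0 => //.
  exact: (mulr_ge0 (Nf0 _) (powR_ge0 _ _)).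
have -> : (\int[mu]_x ((b x)%:E * hoelder_density f x) =
    \int[mu]_x \int[mu]_y G (x, y))%E.
  apply: eq_integral => x _; rewrite -ge0_integralZl//.
  - apply/measurable_EFinP; apply: measurable_funM => //.
    exact: (measurable_fun_pair2 (f := fun z => D z.1 z.2) x mD).
  - by move=> y _; rewrite lee_fin; exact: (mulr_ge0 (Nf0 _) (D0 _ _)).
  - by rewrite lee_fin.
rewrite (fubini_tonelli G)//.
apply: (@le_trans _ _ (\int[mu]_y \int[leb]_t T (y, t)))%E.
  apply: ge0_le_integral => //.
  - by move=> y _; exact: integral_ge0.
  - exact: (measurable_fun_fubini_tonelli_G (m1 := mu) G).
  - exact: (measurable_fun_fubini_tonelli_F (m2 := leb) T).
  move=> y _; have := heis_norm_ge0 y; rewrite le_eqVlt => /predU1P[y0|y0].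
    rewrite integral0_eq ?integral_ge0// => x _.
    rewrite /G /D /= -y0 expr0n (_ : (Q == 0)%N = false) ?invr0 ?mulr0//.
    by rewrite /homdim addn2.
  pose h (t : R) : \bar R := (w t * ((t * heis_norm y <= r)%R%:R *
    (Nf y * heis_norm y `^ gamma)))%:E.
  have mh : measurable_fun [set: RT] h.
    apply/measurable_EFinP; apply: measurable_funM; first exact: mw.
    apply: measurable_funM; last exact: measurable_cst.
    by apply: measurable_bool_indicator; apply: measurable_fun_ler => //;
      exact: measurable_funM.
  have h0 t : (0 <= h t)%E.
    rewrite lee_fin; apply: (mulr_ge0 (w0 _)).
    by apply: mulr_ge0 => //; exact: (mulr_ge0 (Nf0 _) (powR_ge0 _ _)).
  rewrite le_eqVlt; apply/orP; left; apply/eqP.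
  pose u (t : R) : \bar R := ((t <= r)%R%:R * t `^ gamma * (Nf y *
    (phi (t / heis_norm y) * (t / heis_norm y) `^ (alpha * lambda * (q - 1))
     / heis_norm y ^+ Q)))%:E.
  rewrite [LHS](polar_radial polar (u := u)); last 2 first.
  - apply/measurable_EFinP; apply: measurable_funM.
      apply: measurable_funM; last exact: measurable_powR.
      by apply: measurable_bool_indicator; exact: measurable_fun_ler.
    apply: measurable_funM => //; apply: measurable_funM => //.
    have mdiv : measurable_fun [set: RT] (fun t => t / heis_norm y).
      exact: measurable_funM.
    exact: (measurableT_comp (measurable_radial_weight _) mdiv).
  - move=> t; rewrite lee_fin !mulr_ge0 ?powR_ge0 ?radial_profile_ge0//.
    by rewrite invr_ge0 exprn_ge0// ltW.
  transitivity ((\int[leb]_(t in pos) (h (t / heis_norm y)%R * (heis_norm y)^-1%:E))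
      * sigma S)%E.
    congr (_ * _)%E; apply: eq_integral => t; rewrite inE/= in_itv/= andbT => t0.
    by rewrite /u /h -!EFinM dilated_weight_scaling.
  rewrite half_line_scaling//; last exact: measurable_funTS.
  rewrite (sphere_fin polar) -/sg muleC -ge0_integralZl//; last 2 first.
  - exact: measurable_funTS.
  - by rewrite lee_fin ltW.
  rewrite (integral_bool _ (b := fun t : RT => 0 < (t : R))).
    by apply: eq_integral => t _; rewrite /T /h/= -!EFinM.
  by move=> t /=; rewrite in_itv/= andbT.
rewrite (fubini_tonelli T)//.
set K := sg * (M `^ q * ball_weight sigma gamma r `^ (1 + lambda * q)).
have K0 : 0 <= K by apply: (mulr_ge0 (ltW sg0)); rewrite mulr_ge0 ?powR_ge0.
pose g (t : R) := phi t * t `^ (- (alpha * lambda)) * t `^ (-1).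
have mg : measurable_fun [set: RT] g.
  apply: measurable_funM; first exact: measurable_radial_weight.
  exact: measurable_powR.
have g0 t : 0 <= g t by rewrite !mulr_ge0 ?powR_ge0 ?radial_profile_ge0.
have -> : dilation_constant = (\int[leb]_(t in pos) (g t)%:E)%E.
  rewrite dilation_constantE; apply: eq_integral => t.
  by rewrite inE/= in_itv/= andbT => t0; rewrite /g powR_inv1 ?(ltW t0)// EFinM.
rewrite -ge0_integralZl//; last 2 first.
- by apply/measurable_EFinP; exact: measurable_funTS.
- by move=> t _; rewrite lee_fin.
rewrite (integral_bool _ (b := fun t : RT => 0 < (t : R))); last first.
  by move=> t /=; rewrite in_itv/= andbT.
have mKg : measurable_fun [set: RT]
    (fun t : RT => ((0 < (t : R))%R%:R%:E * (K%:E * (g t)%:E))%E).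
  apply: emeasurable_funM.
    apply/measurable_EFinP; apply: measurable_bool_indicator.
    exact: measurable_fun_ltr.
  by apply: emeasurable_funM => //; exact/measurable_EFinP.
apply: ge0_le_integral => //.
- by move=> t _; exact: integral_ge0.
- exact: (measurable_fun_fubini_tonelli_G (m1 := mu) T).
move=> t _; have [t0|t0] := ltP 0 t; last first.
  rewrite integral0_eq ?mul0e// => y _.
  by rewrite /T/= ltNge t0 mul0r.
have Wt := fM (r / t) (divr_gt0 r0 t0).
have -> : (\int[mu]_y T (y, t) =
    (sg * w t)%:E * weighted_Lq_int q omega f (heis_ball (r / t)))%E.
  rewrite weighted_Lq_int_ballE -ge0_integralZl//.
  - apply: eq_integral => y _; rewrite /T/= t0 mul1r -EFinM ler_pdivlMr//.
    by rewrite [heis_norm y * t]mulrC -[in RHS]mulrA.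
  - apply/measurable_EFinP; apply: measurable_funM.
      apply: measurable_bool_indicator; apply: measurable_fun_ler => //.
      exact: measurable_heis_norm.
    apply: measurable_funM => //.
    exact: (measurableT_comp (measurable_powR _) measurable_heis_norm).
  - move=> y _; rewrite lee_fin; apply: mulr_ge0 => //.
    exact: (mulr_ge0 (Nf0 _) (powR_ge0 _ _)).
  - by rewrite lee_fin; exact: (mulr_ge0 (ltW sg0) (w0 _)).
rewrite mul1e -EFinM.
apply: (@le_trans _ _ ((sg * w t)%:E *
    (M `^ q * ball_weight sigma gamma (r / t) `^ (1 + lambda * q))%:E)%E).
  apply: lee_wpmul2l => //.
  by rewrite lee_fin; exact: (mulr_ge0 (ltW sg0) (w0 _)).
rewrite -EFinM lee_fin le_eqVlt; apply/orP; left; apply/eqP.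
have bw0 : 0 <= ball_weight sigma gamma r by rewrite ltW// ball_weight_gt0.
have := dilated_weight_exponents t0; rewrite -/(w t) -/(g t) => <-.
rewrite ball_weight_div// powRM ?powR_ge0// /K; move: (w t) => wt.
by ring.
Qed.

Lemma measurable_hoelder_density (f : H -> R[i]) : cmeasurable_fun setT f ->
  measurable_fun setT (hoelder_density f).
Proof.
move=> mf; pose D (z : H * H) := normc (f z.2) `^ q *
  (phi (heis_norm z.1 / heis_norm z.2) *
   (heis_norm z.1 / heis_norm z.2) `^ (alpha * lambda * (q - 1))
   / heis_norm z.2 ^+ Q).
have mD : measurable_fun setT (EFin \o D).
  apply/measurable_EFinP; apply: measurable_funM.
    apply: (measurableT_comp (measurable_powR _)).
    exact: (measurableT_comp (measurable_normc measurableT mf) measurable_snd).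
  exact: measurable_dilated_weight.
have D0 z : (0 <= (EFin \o D) z)%E.
  rewrite /= lee_fin mulr_ge0 ?powR_ge0//.
  by rewrite !mulr_ge0 ?radial_profile_ge0 ?powR_ge0 ?invr_ge0 ?exprn_ge0
    ?heis_norm_ge0.
exact: (measurable_fun_fubini_tonelli_F (m2 := mu) (EFin \o D) mD D0).
Qed.

Lemma ae_heis_norm_gt0 : \forall x \ae mu, 0 < heis_norm x.
Proof.
exists [set x | heis_norm x = 0]; split.
- rewrite -[X in measurable X]setTI.
  exact: (measurable_heis_norm measurableT (measurable_set1 0)).
- exact: lebesgue_heis_zero polar.
- move=> x /= /negP; rewrite -leNgt => x0.
  by apply/eqP; rewrite eq_le x0 heis_norm_ge0.
Qed.

(** The pointwise bound of [hausdorff_kernel_hoelder] is integrated over balls.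
    Convergence of the integral for almost every x comes from the finiteness of
    the integrals of the Hoelder density over the balls of integer radius. *)
Lemma hausdorff_upper_bound (f : H -> R[i]) (c1 nO : R) :
    0 <= c1 -> dilation_constant = c1%:E ->
    0 <= nO -> (\int[sigma]_(y in S) (normc (Omega y) `^ q')%:E = nO%:E)%E ->
    morrey q lambda omega f ->
  let C := fine (sigma S) `^ q^-1 * (c1 * nO `^ q'^-1) in
  [/\ (\forall x \ae mu, cintegrable mu setT (hausdorff_kernel Phi Omega f x)),
      morrey q lambda omega (hausdorff Phi Omega f) &
      (morrey_norm q lambda omega (hausdorff Phi Omega f) <=
         C%:E * morrey_norm q lambda omega f)%E].
Proof.
move=> c10 C1E nO0 nOE [[mf _] normf] C.
have sg0 := fine_sphere_gt0 polar.
set M := fine (morrey_norm q lambda omega f).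
have ME : morrey_norm q lambda omega f = M%:E.
  by rewrite fineK// ge0_fin_numE//; exact: morrey_norm_ge0.
have M0 : 0 <= M by rewrite -lee_fin -ME; exact: morrey_norm_ge0.
have C0 : 0 <= C by rewrite !mulr_ge0 ?powR_ge0.
have fM := (morrey_norm_leP polar lambda q_gt0 homdim_gamma f M0).1 _.
rewrite -ME in fM; have {}fM := fM (lexx _).
have mJ := measurable_hoelder_density mf.
have J0 := hoelder_density_ge0 f.
pose A := (c1 * nO) `^ q'^-1.
have A0 : 0 <= A by exact: powR_ge0.
have kernel_le x : 0 < heis_norm x ->
    (\int[mu]_y (normc (hausdorff_kernel Phi Omega f x y))%:E <=
     A%:E * hoelder_density f x `^ q^-1)%E.
  move=> x0; apply: le_trans (hausdorff_kernel_hoelder mf x0) _.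
  by rewrite C1E nOE -EFinM poweR_EFin.
have mk x := measurable_hausdorff_kernel2 mPhi rPhi mOmega x mf.
have mHf := measurable_hausdorff mPhi rPhi mOmega mf.
have pointwise x : 0 < heis_norm x ->
    ((normc (hausdorff Phi Omega f x) `^ q)%:E <=
     (A `^ q)%:E * hoelder_density f x)%E.
  move=> x0.
  have := le_trans (le_normc_cintegral mu measurableT (mk x)) (kernel_le x x0).
  rewrite -/(hausdorff Phi Omega f x).
  move: (normc _) (normc_ge0 (hausdorff Phi Omega f x)) => z z0.
  move=> /(gt0_ler_poweR (ltW q_gt0)).
  rewrite poweR_EFin poweRM ?poweR_ge0 ?lee_fin// -poweRrM mulVf ?gt_eqF//.
  rewrite poweRe1// poweR_EFin; apply; rewrite in_itv/= leey andbT ?lee_fin//.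
  by rewrite mule_ge0 ?poweR_ge0 ?lee_fin.
pose b r (x : H) : R := (heis_norm x <= r)%R%:R * heis_norm x `^ gamma.
have mb r : measurable_fun setT (b r).
  apply: measurable_funM.
    apply: measurable_bool_indicator; apply: measurable_fun_ler => //.
    exact: measurable_heis_norm.
  exact: (measurableT_comp (measurable_powR _) measurable_heis_norm).
have b0 r x : 0 <= b r x by rewrite mulr_ge0 ?powR_ge0.
have mbJ r : measurable_fun setT (fun x => (b r x)%:E * hoelder_density f x)%E.
  by apply: emeasurable_funM => //; exact/measurable_EFinP.
have intJ r : 0 < r -> (\int[mu]_x ((b r x)%:E * hoelder_density f x) <=
    (fine (sigma S) * (M `^ q * ball_weight sigma gamma r `^ (1 + lambda * q))
      * c1)%:E)%E.
  move=> r0; apply: le_trans (hoelder_density_integral mf r0 fM) _.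
  by rewrite C1E -EFinM.
have Hf_le : (morrey_norm q lambda omega (hausdorff Phi Omega f) <= (C * M)%:E)%E.
  apply/(morrey_norm_leP polar lambda q_gt0 homdim_gamma) => [|r r0].
    by rewrite mulr_ge0.
  rewrite weighted_Lq_int_ballE.
  apply: (@le_trans _ _ (\int[mu]_x ((A `^ q)%:E *
      ((b r x)%:E * hoelder_density f x)))%E).
    apply: ae_ge0_le_integral => //.
    - by move=> x _; rewrite lee_fin !mulr_ge0 ?powR_ge0.
    - apply/measurable_EFinP; apply: measurable_funM.
        apply: measurable_bool_indicator; apply: measurable_fun_ler => //.
        exact: measurable_heis_norm.
      apply: measurable_funM.
        apply: (measurableT_comp (measurable_powR _)).
        exact: measurable_normc.
      exact: (measurableT_comp (measurable_powR _) measurable_heis_norm).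
    - by move=> x _; rewrite !mule_ge0 ?lee_fin ?powR_ge0.
    - exact: emeasurable_funM.
    - apply: filterS ae_heis_norm_gt0 => x x0 _.
      rewrite [_ * heis_norm x `^ gamma]mulrC mulrA -/(b r x) EFinM.
      rewrite [leRHS]muleCA; apply: lee_wpmul2l; rewrite ?lee_fin//.
      exact: pointwise.
  rewrite ge0_integralZl//; last 2 first.
  - by move=> x _; rewrite mule_ge0 ?lee_fin.
  - by rewrite lee_fin powR_ge0.
  apply: (@le_trans _ _ ((A `^ q)%:E * (fine (sigma S) *
    (M `^ q * ball_weight sigma gamma r `^ (1 + lambda * q)) * c1)%:E)%E).
    by apply: lee_wpmul2l; [rewrite lee_fin powR_ge0|exact: intJ].
  rewrite -EFinM lee_fin le_eqVlt; apply/orP; left; apply/eqP.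
  have qE : q / q' + 1 = q.
    by rewrite -[RHS]mulr1 -[in RHS]conj_qq' mulrDr divff ?gt_eqF// addrC.
  have c1q : c1 `^ (q / q') * c1 = c1 `^ q.
    rewrite -{2}[c1]powRr1// -powRD qE//.
    by rewrite (gt_eqF q_gt0).
  have -> : A `^ q = c1 `^ (q / q') * nO `^ (q / q').
    by rewrite /A -powRrM [q'^-1 * q]mulrC powRM.
  have -> : (C * M) `^ q =
      fine (sigma S) * (c1 `^ q * nO `^ (q / q')) * M `^ q.
    rewrite powRM// /C powRM ?powR_ge0 ?mulr_ge0 ?powR_ge0//.
    rewrite -[(_ `^ q^-1) `^ q]powRrM mulVf ?gt_eqF// powRr1 ?(ltW sg0)//.
    rewrite [(c1 * _) `^ q]powRM ?powR_ge0// -[(nO `^ _) `^ _]powRrM.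
    by rewrite [q'^-1 * q]mulrC.
  by rewrite -c1q; ring.
split.
- have intJ_fin : \forall x \ae mu, forall k : nat,
      ((b k.+1%:R x)%:E * hoelder_density f x)%E \is a fin_num.
    apply: ae_foralln => k.
    have Ik : mu.-integrable setT
        (fun x => (b k.+1%:R x)%:E * hoelder_density f x)%E.
      apply/integrableP; split => //.
      under eq_integral do rewrite gee0_abs ?mule_ge0 ?lee_fin//.
      by apply: le_lt_trans (intJ _ _) _; rewrite ?ltry.
    by apply: filterS (integrable_ae measurableT Ik) => x; exact.
  apply: filterS2 ae_heis_norm_gt0 intJ_fin => x x0 /(_ (Num.truncn (heis_norm x))).
  rewrite /b ltW ?truncnS_gt// mul1r => Jfin.
  split; first exact: mk.
  apply: le_lt_trans (kernel_le x x0) _.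
  apply: lte_mul_pinfty; rewrite ?lee_fin// ?poweR_lty//.
  rewrite ltey; apply/eqP => Joo; move: Jfin; rewrite Joo gt0_muley//.
  by rewrite lte_fin powR_gt0.
- apply: (morrey_of_norm_le polar q_gt0 homdim_gamma (M := C * M)) => //.
  by rewrite mulr_ge0.
- by rewrite ME -EFinM.
Qed.

(** * Lower bound *)

Context (lambda_gt : - q^-1 < lambda).
Local Notation beta := (alpha * lambda).

Lemma morrey_exponent_gt0 : 0 < 1 + lambda * q.
Proof.
move: lambda_gt; rewrite -(ltr_pM2r q_gt0) mulNr mulVf ?gt_eqF// => lq.
by lra.
Qed.

(** Homogeneity is stated off the origin, which is a null set: at the origin the
    powers of 0 on the two sides could disagree. *)
Lemma weighted_Lq_int_homogeneous (g : H -> R[i]) (v : H -> R) (r : R) :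
    cmeasurable_fun setT g -> 0 < r ->
    measurable_fun S v -> (forall y, 0 <= v y) ->
    (forall x, 0 < heis_norm x ->
      normc (g x) `^ q = v (heis_angle x) * heis_norm x `^ (beta * q)) ->
  (weighted_Lq_int q omega g (heis_ball r) =
   (r `^ (alpha * (1 + lambda * q)) / (alpha * (1 + lambda * q)))%:E *
   \int[sigma]_(y in S) (v y)%:E)%E.
Proof.
move=> mg r0 mv v0 gE; have e0 := morrey_exponent_gt0.
have expE : alpha * (1 + lambda * q) = Q%:R + (beta * q + gamma) by ring.
rewrite weighted_Lq_int_ballE expE -(polar_power polar)//; last 2 first.
- by rewrite -expE mulr_gt0.
- exact/measurable_EFinP.
have mball : measurable_fun setT (fun x : H => (heis_norm x <= r)%R%:R : R).
  apply: measurable_bool_indicator; apply: measurable_fun_ler => //.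
  exact: measurable_heis_norm.
have mpow p : measurable_fun setT (fun x : H => heis_norm x `^ p).
  exact: (measurableT_comp (measurable_powR _) measurable_heis_norm).
apply: ge0_ae_eq_integral => //.
- apply/measurable_EFinP; apply: measurable_funM => //; apply: measurable_funM => //.
  apply: (measurableT_comp (measurable_powR _)); exact: measurable_normc.
- apply: emeasurable_funM; apply/measurable_EFinP; first exact: measurable_funM.
  exact: measurable_comp_angle.
- by move=> x _; rewrite lee_fin !mulr_ge0 ?powR_ge0.
- by move=> x _; rewrite -EFinM lee_fin !mulr_ge0 ?powR_ge0.
apply: filterS ae_heis_norm_gt0 => x x0 _.
rewrite gE// -EFinM powRD; last by rewrite (gt_eqF x0) implybT.
by congr EFin; ring.
Qed.

(** conj(Omega(y')) |Omega(y')|^(q'-2) |y|^beta, the function for which Hoelder's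
    inequality in [hausdorff_kernel_hoelder] is an equality. *)
Definition extremal (y : H) : R[i] :=
  let g := normc (Omega (heis_angle y)) `^ (q' - 2) * heis_norm y `^ beta in
  Complex (g * complex.Re (Omega (heis_angle y)))
    (- (g * complex.Im (Omega (heis_angle y)))).

Lemma measurable_extremal : cmeasurable_fun setT extremal.
Proof.
have [mr mi] := mOmega.
have mg : measurable_fun setT (fun y : H =>
    normc (Omega (heis_angle y)) `^ (q' - 2) * heis_norm y `^ beta).
  apply: measurable_funM.
    apply: (measurableT_comp (measurable_powR _)).
    apply: (measurable_comp_angle (v := fun y => normc (Omega y))).
    by apply: measurable_normc => //; exact: measurable_heis_sphere.
  exact: (measurableT_comp (measurable_powR _) measurable_heis_norm).
split => /=.
  by apply: measurable_funM => //; exact: (measurable_comp_angle mr).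
apply: measurable_funN.
by apply: measurable_funM => //; exact: (measurable_comp_angle mi).
Qed.

Lemma conj_exponent_gt1 : 1 < q -> 1 < q'.
Proof.
move=> q1; rewrite -invf_lt1// -conj_qq' ltrDr invr_gt0//.
Qed.

Lemma normc_extremal y : 1 < q ->
  normc (extremal y) =
  normc (Omega (heis_angle y)) `^ (q' - 1) * heis_norm y `^ beta.
Proof.
move=> q1; rewrite /extremal; set z := Omega _.
set g := normc z `^ _ * _.
have g0 : 0 <= g by rewrite mulr_ge0 ?powR_ge0.
have -> : normc (Complex (g * complex.Re z) (- (g * complex.Im z))) = g * normc z.
  apply/eqP; rewrite -(@eqrXn2 _ 2) ?normc_ge0//; last first.
    exact: (mulr_ge0 g0 (normc_ge0 z)).
  by rewrite exprMn !sqr_normcE/= sqrrN !exprMn mulrDr.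
rewrite /g mulrAC; congr (_ * _).
have := normc_ge0 z; rewrite le_eqVlt => /predU1P[<-|z0].
  by rewrite mulr0 powR0// subr_eq0 gt_eqF// conj_exponent_gt1.
rewrite -{2}[normc z]powRr1 ?normc_ge0// -powRD; last by rewrite (gt_eqF z0) implybT.
by congr (_ `^ _); ring.
Qed.

(** The phases of Omega and of the extremal function cancel, so the kernel is
    nonnegative and the modulus of its integral is the integral of its modulus. *)
Lemma hausdorff_kernel_extremal x y :
  hausdorff_kernel Phi Omega extremal x y =
  Complex (phi (heis_norm x / heis_norm y) / heis_norm y ^+ Q *
    (normc (Omega (heis_angle y)) `^ q' * heis_norm y `^ beta)) 0.
Proof.
rewrite hausdorff_kernelE// /extremal; set z := Omega _.
move: (phi _ / _) => k; set g := normc z `^ (q' - 2).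
have gE : normc z `^ q' = g * (complex.Re z ^+ 2 + complex.Im z ^+ 2).
  rewrite /g -sqr_normcE.
  have := normc_ge0 z; rewrite le_eqVlt => /predU1P[<-|z0].
    by rewrite expr0n mulr0 powR0// gt_eqF.
  rewrite -powR_mulrn ?normc_ge0// -powRD; last by rewrite (gt_eqF z0) implybT.
  by rewrite subrK.
rewrite gE {gE}; move: g (heis_norm y `^ _) => g p; case: z => a b.
apply/eqP; rewrite eq_complex/=.
by apply/andP; split; apply/eqP; ring.
Qed.

Lemma integral_kernel_extremal (x : H) : 0 < heis_norm x ->
  (\int[mu]_y (phi (heis_norm x / heis_norm y) / heis_norm y ^+ Q *
     (normc (Omega (heis_angle y)) `^ q' * heis_norm y `^ beta))%:E =
   (heis_norm x `^ beta)%:E *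
     (dilation_constant * \int[sigma]_(y in S) (normc (Omega y) `^ q')%:E))%E.
Proof.
move=> x0.
have mv : measurable_fun S (fun y => (normc (Omega y) `^ q')%:E).
  apply/measurable_EFinP; apply: (measurableT_comp (measurable_powR _)).
  by apply: measurable_normc => //; exact: measurable_heis_sphere.
rewrite -(polar_dilated_weight x0 mv); last by move=> y; rewrite lee_fin powR_ge0.
pose w (y : H) : R := phi (heis_norm x / heis_norm y) *
  (heis_norm x / heis_norm y) `^ (- beta) / heis_norm y ^+ Q.
have mw : measurable_fun setT w.
  exact: (measurable_fun_pair2 x (measurable_dilated_weight (- beta))).
have w0 y : 0 <= w y.
  by rewrite !mulr_ge0 ?radial_profile_ge0 ?powR_ge0 ?invr_ge0 ?exprn_ge0
    ?heis_norm_ge0.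
rewrite -ge0_integralZl; last 4 first.
- exact: measurableT.
- apply: emeasurable_funM; last exact: (measurable_comp_angle mv).
  exact/measurable_EFinP.
- by move=> y _; rewrite mule_ge0 ?lee_fin ?powR_ge0//; exact: w0.
- by rewrite lee_fin powR_ge0.
apply: eq_integral => y _; rewrite -!EFinM; congr EFin.
have := heis_norm_ge0 y; rewrite le_eqVlt => /predU1P[<-|y0].
  have Q0 : (Q == 0)%N = false by rewrite /homdim addn2.
  by rewrite expr0n Q0 /= !invr0 !mulr0 !mul0r mulr0.
have -> : (heis_norm x / heis_norm y) `^ (- beta) =
    (heis_norm x `^ beta)^-1 * heis_norm y `^ beta.
  rewrite powRM ?invr_ge0 ?heis_norm_ge0// powRN.
  by rewrite powR_inv_opp ?heis_norm_ge0.
have xb : heis_norm x `^ beta != 0 by rewrite gt_eqF// powR_gt0.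
have yQ : heis_norm y ^+ Q != 0 by rewrite expf_neq0// gt_eqF.
move: xb yQ; move: (heis_norm x `^ beta) (heis_norm y ^+ Q) (heis_norm y `^ beta).
move: (phi _) (_ `^ q') => k N a b c a0 b0.
by field; rewrite a0 b0.
Qed.

Lemma heis_ae_exists (P : H -> Prop) : (\forall x \ae mu, P x) -> exists x, P x.
Proof.
move=> [N [mN N0 PN]]; apply: contrapT => nP.
have /eqP := @lebesgue_heis_setT_neq0 R n; apply.
apply/eqP; rewrite eq_le measure_ge0 andbT -N0; apply: le_measure; rewrite ?inE//.
by move=> x _; apply: PN => Px; apply: nP; exists x.
Qed.

Lemma ball_weight_pow r : 0 < r ->
  ball_weight sigma gamma r `^ (1 + lambda * q) =
  (fine (sigma S) / alpha) `^ (1 + lambda * q) * r `^ (alpha * (1 + lambda * q)).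
Proof.
move=> r0; have sg0 := fine_sphere_gt0 polar.
rewrite /ball_weight -mulrA [r `^ _ * _]mulrC [alpha^-1 * _]mulrC.
by rewrite powRM ?powR_ge0 ?divr_ge0 ?ltW// [in RHS]powRrM.
Qed.

Section lower_bound.
Context (q_gt1 : 1 < q) (nO : R) (nO_gt0 : 0 < nO).
Context (nOE : (\int[sigma]_(y in S) (normc (Omega y) `^ q')%:E = nO%:E)%E).
Local Notation expo := (alpha * (1 + lambda * q)).
Local Notation D := (nO / expo).
Local Notation B := ((fine (sigma S) / alpha) `^ (1 + lambda * q)).

Let expo_gt0 : 0 < expo.
Proof. by rewrite mulr_gt0// morrey_exponent_gt0. Qed.

Let B_gt0 : 0 < B.
Proof. by rewrite powR_gt0// divr_gt0// fine_sphere_gt0. Qed.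

Let mNq : measurable_fun S (fun y => normc (Omega y) `^ q').
Proof.
apply: (measurableT_comp (measurable_powR _)).
by apply: measurable_normc => //; exact: measurable_heis_sphere.
Qed.

Lemma weighted_Lq_int_extremal r : 0 < r ->
  weighted_Lq_int q omega extremal (heis_ball r) = (D * r `^ expo)%:E.
Proof.
move=> r0.
rewrite (weighted_Lq_int_homogeneous (v := fun y => normc (Omega y) `^ q') _ r0)//.
- by rewrite nOE -EFinM; congr EFin; ring.
- exact: measurable_extremal.
- by move=> y; exact: powR_ge0.
move=> x x0; rewrite normc_extremal//.
move: (normc _) (normc_ge0 (Omega (heis_angle x))) => z z0.
move: (heis_norm x) x0 => s s0.
rewrite powRM ?powR_ge0// -!powRrM; congr (_ `^ _ * _).
have pq : q' + q = q * q'.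
  by rewrite -[RHS]mulr1 -[in RHS]conj_qq'; field; rewrite !gt_eqF.
by rewrite mulrBl mul1r [q' * q]mulrC -pq addrK.
Qed.

Let M_pow : ((D / B) `^ q^-1) `^ q * B = D.
Proof.
by rewrite -powRrM mulVf ?gt_eqF// powRr1 ?divfK ?gt_eqF// divr_ge0 ?ltW// divr_gt0.
Qed.

Lemma morrey_norm_extremal_le :
  (morrey_norm q lambda omega extremal <= ((D / B) `^ q^-1)%:E)%E.
Proof.
apply/(morrey_norm_leP polar lambda q_gt0 homdim_gamma); first exact: powR_ge0.
move=> r r0; rewrite weighted_Lq_int_extremal// ball_weight_pow//.
by rewrite mulrA M_pow.
Qed.

Lemma morrey_extremal : morrey q lambda omega extremal.
Proof.
apply: (morrey_of_norm_le polar q_gt0 homdim_gamma (M := (D / B) `^ q^-1)).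
- exact: powR_ge0.
- exact: measurable_extremal.
- exact: morrey_norm_extremal_le.
Qed.

Lemma morrey_norm_extremal_gt0 : (0 < morrey_norm q lambda omega extremal)%E.
Proof.
rewrite ltNge; apply/negP => /(morrey_norm_leP polar lambda q_gt0 homdim_gamma _ (lexx 0)).
move=> /(_ 1 ltr01); rewrite weighted_Lq_int_extremal// lee_fin powR0 ?gt_eqF//.
by rewrite mul0r powR1 mulr1 leNgt divr_gt0.
Qed.

(** At any x off the origin, absolute convergence for the extremal function says
    that |x|^beta * C1 * ||Omega||_q'^q' is finite. *)
Lemma dilation_constant_lty (C : R) :
  hausdorff_bounded_by q lambda omega Phi Omega C -> (dilation_constant < +oo)%E.
Proof.
move=> /(_ _ morrey_extremal)[ae_int _ _].
have [x [x0 [_ intx]]] := heis_ae_exists (filterI ae_heis_norm_gt0 ae_int).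
rewrite ltey; apply/eqP => C1oo; move: intx.
have -> : (\int[mu]_y (normc (hausdorff_kernel Phi Omega extremal x y))%:E =
    (heis_norm x `^ beta)%:E * (dilation_constant * nO%:E))%E.
  rewrite -nOE -integral_kernel_extremal//; apply: eq_integral => y _; congr EFin.
  rewrite hausdorff_kernel_extremal normcE_powR/= expr0n addr0 powR12_sqrt ?sqr_ge0//.
  rewrite sqrtr_sqr ger0_norm//.
  by rewrite !mulr_ge0 ?radial_profile_ge0 ?powR_ge0 ?invr_ge0 ?exprn_ge0
    ?heis_norm_ge0.
have xb : 0 < heis_norm x `^ beta by exact: powR_gt0.
by rewrite C1oo gt0_mulye ?lte_fin// gt0_muley ?lte_fin.
Qed.

Lemma normc_hausdorff_extremal (c1 : R) (x : H) :
  0 <= c1 -> dilation_constant = c1%:E -> 0 < heis_norm x ->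
  normc (hausdorff Phi Omega extremal x) = heis_norm x `^ beta * (c1 * nO).
Proof.
move=> c10 C1E x0.
have -> : hausdorff Phi Omega extremal x =
    Complex (heis_norm x `^ beta * (c1 * nO)) 0.
  rewrite /hausdorff /cintegral; congr Complex.
    rewrite /Rintegral; under eq_integral do rewrite hausdorff_kernel_extremal/=.
    by rewrite integral_kernel_extremal// C1E nOE -!EFinM.
  rewrite /Rintegral; under eq_integral do rewrite hausdorff_kernel_extremal/=.
  by rewrite integral0.
rewrite normcE_powR/= expr0n addr0 powR12_sqrt ?sqr_ge0// sqrtr_sqr ger0_norm//.
by rewrite !mulr_ge0 ?powR_ge0// ltW.
Qed.

(** The operator multiplies the radial part |x|^beta of the extremal function by a
    constant, so comparing the two weighted integrals over the unit ball is
    enough. *)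
Lemma hausdorff_lower_bound (c1 C : R) : 0 <= c1 -> dilation_constant = c1%:E ->
  hausdorff_bounded_by q lambda omega Phi Omega C ->
  fine (sigma S) `^ q^-1 * (c1 * nO `^ q'^-1) <= C.
Proof.
move=> c10 C1E bC; have [_ [[mHf _] _] HfC] := bC _ morrey_extremal.
have sg0 := fine_sphere_gt0 polar.
have C0 : 0 <= C.
  rewrite leNgt; apply/negP => C0.
  have := le_trans (morrey_norm_ge0 q lambda gamma (hausdorff Phi Omega extremal)) HfC.
  by rewrite leNgt mule_lt0_gt0// ?lte_fin// morrey_norm_extremal_gt0.
have : (morrey_norm q lambda omega (hausdorff Phi Omega extremal) <=
    (C * (D / B) `^ q^-1)%:E)%E.
  apply: le_trans HfC _; rewrite EFinM; apply: lee_wpmul2l; rewrite ?lee_fin//.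
  exact: morrey_norm_extremal_le.
move=> /(morrey_norm_leP polar lambda q_gt0 homdim_gamma).
have CM0 : 0 <= C * (D / B) `^ q^-1 by rewrite mulr_ge0 ?powR_ge0.
move=> /(_ CM0 1 ltr01).
rewrite (weighted_Lq_int_homogeneous (v := cst ((c1 * nO) `^ q)))//; last 2 first.
- by move=> y; exact: powR_ge0.
- move=> x x0; rewrite (normc_hausdorff_extremal c10 C1E x0)/=.
  move: (heis_norm x) x0 => s s0.
  by rewrite powRM ?powR_ge0 ?mulr_ge0 ?(ltW nO_gt0)// -powRrM mulrC.
rewrite -[X in (_ * X <= _)%E]/(\int[sigma]_(y in S) cst ((c1 * nO) `^ q)%:E y)%E.
rewrite integral_cst; last exact: measurable_heis_sphere.
rewrite (sphere_fin polar) -!EFinM lee_fin ball_weight_pow// powR1 mulr1 mul1r.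
rewrite [(C * _) `^ q]powRM ?powR_ge0// -[leRHS]mulrA M_pow => main.
have {main} : (c1 * nO) `^ q * fine (sigma S) <= C `^ q * nO.
  rewrite -(ler_pM2l (x := expo^-1)) ?invr_gt0//.
  by rewrite [leRHS]mulrCA [expo^-1 * nO]mulrC.
move=> main.
rewrite leNgt; apply/negP => CL.
have : C `^ q < (fine (sigma S) `^ q^-1 * (c1 * nO `^ q'^-1)) `^ q.
  apply: gt0_ltr_powR => //; rewrite nnegrE//.
  by rewrite !mulr_ge0 ?powR_ge0.
rewrite ltNge => /negP; apply.
rewrite -(ler_pM2r nO_gt0); apply: le_trans main.
rewrite powRM ?mulr_ge0 ?powR_ge0// -[(fine _ `^ _) `^ q]powRrM.
rewrite mulVf ?gt_eqF// powRr1 ?(ltW sg0)// [(c1 * _ `^ _) `^ q]powRM ?powR_ge0//.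
rewrite -[(nO `^ _) `^ q]powRrM.
rewrite powRM ?(ltW nO_gt0)//.
have -> : nO `^ q = nO `^ (q'^-1 * q) * nO.
  rewrite -{3}[nO]powRr1 ?(ltW nO_gt0)// -powRD; last by rewrite (gt_eqF nO_gt0) implybT.
  by congr (_ `^ _); rewrite -[LHS]mul1r -[in LHS]conj_qq'; field; rewrite !gt_eqF.
by rewrite le_eqVlt; apply/orP; left; apply/eqP; ring.
Qed.

End lower_bound.
End hausdorff_operator.

(** * The equivalence and the operator norm *)

Section sphere_norm.
Context {R : realType} {n : nat}.
Context (sigma : {measure set (heis R n) -> \bar R}) (polar : polar_measure sigma).
Context (Omega : heis R n -> R[i]) (mOmega : cmeasurable_fun heis_sphere Omega).
Local Notation S := (@heis_sphere R n).
Local Notation normc := (@Normc.normc R).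

Lemma sphere_integral_gt0 (p : R) : 0 < p ->
  (\forall y \ae sigma, heis_sphere y -> Omega y != 0) ->
  (0 < \int[sigma]_(y in S) (normc (Omega y) `^ p)%:E)%E.
Proof.
move=> p0 Omega_neq0.
have mS := @measurable_heis_sphere R n.
have mNp : measurable_fun S (fun y => (normc (Omega y) `^ p)%:E).
  apply/measurable_EFinP; apply: (measurableT_comp (measurable_powR _)).
  exact: measurable_normc.
rewrite lt0e integral_ge0 ?andbT; last by move=> y _; rewrite lee_fin powR_ge0.
apply/eqP => int0.
have /(ae_eq_integral_abs sigma mS mNp) ae0 :
    (\int[sigma]_(y in S) `|(normc (Omega y) `^ p)%:E| = 0)%E.
  by rewrite -[RHS]int0; apply: eq_integral => y _; rewrite gee0_abs// lee_fin powR_ge0.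
have : \forall y \ae sigma, ~ S y.
  apply: filterS2 ae0 Omega_neq0 => y y0 yN Sy; move: (yN Sy) (y0 Sy).
  move=> /negP Oy [/eqP]; rewrite powR_eq0 normc_eq0 => /andP[] /Oy.
  by [].
move=> [N [mN N0 SN]].
have := sphere_measure_gt0 polar; rewrite lt0e => /andP[/eqP + _]; apply.
apply/eqP; rewrite eq_le measure_ge0 andbT -N0; apply: le_measure; rewrite ?inE//.
by move=> y Sy; apply: SN => /(_ Sy).
Qed.

End sphere_norm.

Theorem theorem3p1 (R : realType) (n : nat) (q q' lambda gamma : R)
    (sigma : {measure set (heis R n) -> \bar R}) :
  (0 < n)%N -> 1 < q -> q^-1 + q'^-1 = 1 ->
  - q^-1 < lambda < 0 -> - (homdim n)%:R < gamma ->
  polar_measure sigma ->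
  let omega (x : heis R n) := heis_norm x `^ gamma in
  exists2 K : R, 0 < K &
    forall (Phi : heis R n -> R) (Omega : heis R n -> R[i]),
      measurable_fun setT Phi -> (forall x, 0 <= Phi x) -> radial Phi ->
      cmeasurable_fun heis_sphere Omega ->
      (\forall y \ae sigma, heis_sphere y -> Omega y != 0) ->
      (sphere_Lnorm sigma q' Omega < +oo)%E ->
      let C1 := (\int[lebesgue_measure]_(t in `]0%R, +oo[)
        (radial_profile Phi t / t `^ (1 + ((homdim n)%:R + gamma) * lambda))%:E)%E
      in
      (hausdorff_bounded q lambda omega Phi Omega <-> (C1 < +oo)%E) /\
      (K^-1%:E * (C1 * sphere_Lnorm sigma q' Omega)
         <= hausdorff_opnorm q lambda omega Phi Omega
         <= K%:E * (C1 * sphere_Lnorm sigma q' Omega))%E.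
Proof.
move=> _ q1 qq' /andP[lambda_gt _] gammaQ polar omega.
have q0 : 0 < q by exact: lt_trans q1.
have q'0 : 0 < q'.
  by rewrite -invr_gt0 -(addKr q^-1 q'^-1) qq' addrC subr_gt0 invf_lt1.
have Qg : 0 < (homdim n)%:R + gamma by rewrite addrC -ltrBlDr sub0r.
set a := fine (sigma heis_sphere) `^ q^-1.
have a0 : 0 < a by rewrite powR_gt0// fine_sphere_gt0.
exists (a + a^-1); first by rewrite addr_gt0 ?invr_gt0.
move=> Phi Omega mPhi Phi0 rPhi mO O0 normO C1.
pose I := (\int[sigma]_(y in heis_sphere) (Normc.normc (Omega y) `^ q')%:E)%E.
have I0 : (0 < I)%E by exact: sphere_integral_gt0.
have IE : I = (fine I)%:E.
  rewrite fineK// ge0_fin_numE ?ltW//.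
  by apply: lty_poweRy normO; rewrite invr_neq0// gt_eqF.
have nO0 : 0 < fine I by rewrite -lte_fin -IE.
have normE : sphere_Lnorm sigma q' Omega = (fine I `^ q'^-1)%:E.
  by rewrite /sphere_Lnorm -/I IE.
have C10 : (0 <= C1)%E by exact: dilation_constant_ge0.
have upper c1 : 0 <= c1 -> C1 = c1%:E ->
    hausdorff_bounded_by q lambda omega Phi Omega (a * (c1 * fine I `^ q'^-1)).
  move=> c10 C1E f mf.
  exact: (hausdorff_upper_bound polar q0 q'0 qq' Qg mPhi Phi0 rPhi mO c10 C1E
    (ltW nO0) IE mf).
have lower c1 C : 0 <= c1 -> C1 = c1%:E ->
    hausdorff_bounded_by q lambda omega Phi Omega C ->
    a * (c1 * fine I `^ q'^-1) <= C.
  move=> c10 C1E.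
  exact: (hausdorff_lower_bound polar q0 q'0 qq' Qg mPhi Phi0 rPhi mO lambda_gt q1
    nO0 IE c10 C1E).
have finite C : hausdorff_bounded_by q lambda omega Phi Omega C -> (C1 < +oo)%E.
  exact: (dilation_constant_lty polar q0 q'0 qq' Qg mPhi Phi0 rPhi mO lambda_gt q1
    nO0 IE).
have C1_fin : (C1 < +oo)%E -> C1 = (fine C1)%:E by move=> ?; rewrite fineK// ge0_fin_numE.
have C1_fine : 0 <= fine C1 by exact: fine_ge0.
(* If C1 is infinite, no bound exists and the infimum is that of the empty set. *)
have opnormE : hausdorff_opnorm q lambda omega Phi Omega =
    (a%:E * (C1 * sphere_Lnorm sigma q' Omega))%E.
  rewrite normE; have [C1oo|C1oo] := eqVneq C1 +oo%E.
    rewrite C1oo gt0_mulye ?lte_fin ?powR_gt0// gt0_muley ?lte_fin//.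
    rewrite /hausdorff_opnorm (_ : [set _ | _ in _] = set0) ?ereal_inf0//.
    by apply/seteqP; split => // t [C /finite + _]; rewrite C1oo ltxx.
  have C1E : C1 = (fine C1)%:E by apply: C1_fin; rewrite ltey.
  rewrite C1E -!EFinM; apply/eqP; rewrite eq_le; apply/andP; split.
    by apply: ereal_inf_lbound; eexists; first exact: (upper _ C1_fine C1E).
  by apply: le_ereal_inf_tmp => _ [C bC <-]; rewrite lee_fin; exact: (lower (fine C1)).
split.
  split; first by move=> [C]; exact: finite.
  by move=> /C1_fin C1E; eexists; exact: (upper _ C1_fine C1E).
have X0 : (0 <= C1 * sphere_Lnorm sigma q' Omega)%E by rewrite mule_ge0 ?poweR_ge0.
rewrite opnormE; apply/andP; split; apply: lee_wpmul2r => //; rewrite lee_fin.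
  by rewrite invf_ple ?posrE ?addr_gt0 ?invr_gt0// lerDr ltW.
by rewrite lerDl invr_ge0 ltW.
Qed.
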